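(* Let $G$ be a Lie group. A twisted principal $[G\rightrightarrows e]$-bundle defines a Lie groupoid $G$-extension and vice versa. Precisely: (1) If $\pi\colon[E_1\rightrightarrows X_0]\to[X_1\rightrightarrows X_0]$ is a twisted principal $[G\rightrightarrows e]$-bundle (with $E_0$ identified with $X_0$ via $\pi_0$), then, with $i\colon X_0\times G\to E_1$, $i(x,g)=1_x\,g$ (where $1_x\in E_1$ is the unit at $x$), the sequence $1\to[X_0\times G\rightrightarrows X_0]\xrightarrow{i}[E_1\rightrightarrows X_0]\xrightarrow{\pi_1}[X_1\rightrightarrows X_0]\to1$ is a Lie groupoid $G$-extension. (2) Conversely, if $1\to[M\times G\rightrightarrows M]\xrightarrow{i}[\Gamma_2\rightrightarrows M]\xrightarrow{\phi}[\Gamma_1\rightrightarrows M]\to1$ is a Lie groupoid $G$-extension, then $(\phi,\mathrm{Id}_M)\colon[\Gamma_2\rightrightarrows M]\to[\Gamma_1\rightrightarrows M]$ is a twisted principal $[G\rightrightarrows e]$-bundle with action $(x\xrightarrow{\gamma}y,\ g)\mapsto\gamma\circ i(x,g)$ and twisting map $\eta(x\xrightarrow{\gamma}y,\ g)=i(y,g)\circ\gamma\circ i(x,g^{-1})$.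
   Context: In a Lie groupoid, source $s$ and target $t$ are surjective submersions and $f_2\circ f_1$ is defined when $t(f_1)=s(f_2)$. $[G\rightrightarrows e]$ is the one-object groupoid with morphism group $G$, composition $g_2\circ g_1=g_2g_1$. Lie groupoid $G$-extension: for a manifold $M$, $[M\times G\rightrightarrows M]$ is the Lie groupoid with $s(m,g)=t(m,g)=m$, $(m,g_2)\circ(m,g_1)=(m,g_2g_1)$. A Lie groupoid $G$-extension is a short exact sequence of Lie groupoids over $M$, $1\to[M\times G\rightrightarrows M]\xrightarrow{i}[\Gamma_2\rightrightarrows M]\xrightarrow{\phi}[\Gamma_1\rightrightarrows M]\to1$, where $i,\phi$ are morphisms of Lie groupoids that are the identity on objects, $i$ is an embedding, $\phi$ is a surjective submersion, and the image of $i$ is $\{\gamma\in\Gamma_2:\phi(\gamma)\text{ is a unit}\}$. Twisted principal $[G\rightrightarrows e]$-bundle over $\mathbb{X}=[X_1\rightrightarrows X_0]$: a morphism of Lie groupoids $\pi\colon\mathbb{E}=[E_1\rightrightarrows E_0]\to\mathbb{X}$, with a smooth map $\eta\colon E_1\times G\to E_1$ and a right action of $G$ on $E_1$ such that: (a) $\eta$ is a twisting map: $\eta(\gamma,k)\in\mathrm{Hom}_{\mathbb{E}}(x,y)$ for $\gamma\in\mathrm{Hom}_{\mathbb{E}}(x,y)$; $\eta(\gamma_2\circ\gamma_1,k)=\eta(\gamma_2,k)\circ\eta(\gamma_1,k)$; $\eta(1_x,k)=1_x$; $\eta(\gamma,k_2k_1)=\eta(\eta(\gamma,k_1),k_2)$;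 $\eta(\gamma,e)=\gamma$. These make $\mathbb{E}\rtimes_\eta[G\rightrightarrows e]$, with objects $E_0$, morphisms $E_1\times G$, source and target $(\gamma,k)\mapsto s(\gamma),t(\gamma)$, and composition $(\gamma_2,k_2)\circ_\eta(\gamma_1,k_1)=(\gamma_2\circ\eta(\gamma_1,k_2),k_2k_1)$, a smooth category. (b) The action is an $\eta$-twisted action, i.e. $(\gamma,k)\mapsto\gamma k$ (with the identity on objects) is a smooth functor $\mathbb{E}\rtimes_\eta[G\rightrightarrows e]\to\mathbb{E}$: $s(\gamma k)=s(\gamma)$, $t(\gamma k)=t(\gamma)$, $1_x e=1_x$, and $(\gamma_2k_2)\circ(\gamma_1k_1)=(\gamma_2\circ\eta(\gamma_1,k_2))(k_2k_1)$. (c) $\pi_0\colon E_0\to X_0$ is a principal bundle for the trivial group (a diffeomorphism) and $\pi_1\colon E_1\to X_1$ is a principal $G$-bundle. *)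

(* Defs.v *)
From HB Require Import structures.
From mathcomp Require Import all_boot all_order all_algebra.
From mathcomp Require Import boolp classical_sets functions cardinality reals.
From mathcomp Require Import topology normedtype landau derive.

Set Implicit Arguments.
Unset Strict Implicit.
Unset Printing Implicit Defensive.

Import Order.TTheory GRing.Theory Num.Theory.
Import numFieldNormedType.Exports.

Local Open Scope classical_set_scope.
Local Open Scope ring_scope.

Section Ck.
Context {R : realType}.
Implicit Types (W : normedModType R) (n m k : nat).

(* On an open set of R^n this is the usual class C^k: the directional          *)
(* derivatives include the partial derivatives.                                *)
Fixpoint Ck n W (k : nat) (U : set 'rV[R]_n) (f : 'rV[R]_n -> W) : Prop :=
  match k with
  | 0%N => forall x, U x -> {for x, continuous f}
  | k'.+1 => (forall x, U x -> differentiable f x) /\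
             forall v, Ck k' U (fun x => 'D_v f x)
  end.

Definition Cinfty n m (U : set 'rV[R]_n) (f : 'rV[R]_n -> 'rV[R]_m) :=
  forall k, Ck k U f.

Lemma Ck_local n W k (U : set 'rV[R]_n) (f : 'rV[R]_n -> W) :
  (forall x, U x -> exists2 V, V x & Ck k V f) -> Ck k U f.
Proof.
elim: k U f => [|k IH] U f /= h; first by move=> x /h[V Vx]; exact.
split=> [x /h[V Vx [+ _]]|v]; first exact.
by apply: IH => x /h[V Vx [_ hV]]; exists V.
Qed.

Lemma Ck_sub n W k (U V : set 'rV[R]_n) (f : 'rV[R]_n -> W) :
  U `<=` V -> Ck k V f -> Ck k U f.
Proof. by move=> UV fV; apply: Ck_local => x /UV Vx; exists V. Qed.

Lemma Ck_pred n W k (U : set 'rV[R]_n) (f : 'rV[R]_n -> W) :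
  Ck k.+1 U f -> Ck k U f.
Proof.
elim: k U f => [|k IH] U f [df Df].
  by move=> x /df; exact: differentiable_continuous.
by split=> // v; apply: IH; exact: Df.
Qed.

Lemma Ck_continuous n W k (U : set 'rV[R]_n) (f : 'rV[R]_n -> W) x :
  Ck k U f -> U x -> {for x, continuous f}.
Proof. by elim: k => [|k IH] fk; [exact: fk|exact/IH/Ck_pred]. Qed.

Lemma near0_differentiable n W (h : 'rV[R]_n -> W) x :
  (\forall y \near x, h y = 0) -> differentiable h x /\ 'd h x = 0 :> (_ -> _).
Proof.
move=> h0.
have hx : continuous (0 : 'rV[R]_n -> W) /\
    h \o shift x = cst (h x) + \0 +o_ (0 : 'rV[R]_n) id.
  split; first exact: cst_continuous.
  have h0' : \forall y \near (0 : 'rV[R]_n), h (y + x) = 0.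
    by rewrite (near_shift x) sub0r; apply: filterS h0 => y /=; rewrite subrK.
  apply/eqaddoP => e e0; near=> y.
  rewrite !fctE /= (nbhs_singleton h0) !addr0 subr0.
  have -> : h (y + x) = 0 by near: y.
  by rewrite normr0 mulr_ge0 // ltW.
have dh : 'd h x = 0 :> (_ -> _) by case: hx => c e; apply/diff_unique.
by split => //; apply/diff_locallyP; rewrite dh.
Unshelve. all: by end_near. Qed.

Lemma near_eq_diff n W (f g : 'rV[R]_n -> W) x :
  (\forall y \near x, f y = g y) -> differentiable f x ->
  differentiable g x /\ 'd g x = 'd f x :> (_ -> _).
Proof.
move=> fg df.
have [d0 e0] : differentiable (g - f) x /\ 'd (g - f) x = 0 :> (_ -> _).
  apply: near0_differentiable; near=> y; rewrite !fctE.
  by apply/eqP; rewrite subr_eq0; apply/eqP/esym; near: y.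
have -> : g = f + (g - f) by rewrite addrC subrK.
split; first exact: differentiableD.
apply: etrans (diffD df d0) _; apply/funext => y.
have /= e0y := congr1 (@^~ y) e0.
by apply: etrans (congr1 (+%R ('d f x y)) e0y) _; rewrite addr0.
Unshelve. all: by end_near. Qed.

Lemma diff_right_inverse n m (F : 'rV[R]_n -> 'rV[R]_m)
    (S : 'rV[R]_m -> 'rV[R]_n) x y :
  differentiable S y -> differentiable F x -> S y = x ->
  (\forall v \near y, v = F (S v)) -> forall w, 'd F x ('d S y w) = w.
Proof.
move=> dS + Sx; rewrite -{}Sx => dF e w.
have di : differentiable (idfun : 'rV[R]_m -> _) y.
  by apply: (@linear_differentiable _ _ _ idfun) => ?.
have [_ eFS] := near_eq_diff (f := idfun) (g := F \o S) e di.
have did : 'd idfun y = idfun :> (_ -> _) by apply: diff_lin => ?.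
have /= := congr1 (@^~ w) (etrans (esym (diff_comp dS dF)) (etrans eFS did)).
exact.
Qed.

Lemma Ck_ext n W k (U : set 'rV[R]_n) (f g : 'rV[R]_n -> W) :
  open U -> (forall x, U x -> f x = g x) -> Ck k U f -> Ck k U g.
Proof.
move=> oU; elim: k f g => [|k IH] f g fg.
  move=> fc x Ux; have nU : nbhs x U by exact: open_nbhs_nbhs.
  rewrite /prop_for /continuous_at -(fg _ Ux).
  apply: (@cvg_trans _ (f @ x)); last exact: fc.
  by apply: (@near_eq_cvg _ _ (nbhs x)); near=> y; apply: fg; near: y.
have nfg x : U x -> \forall y \near x, f y = g y.
  by move=> Ux; apply: filterS (open_nbhs_nbhs (conj oU Ux)) => y /fg.
case=> df Df; split=> [x Ux|v].
  by have [] := near_eq_diff (nfg x Ux) (df x Ux).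
apply: IH (Df v) => x Ux; exact: near_eq_derive (nfg x Ux).
Unshelve. all: by end_near. Qed.

Lemma Ck_cst n W k (U : set 'rV[R]_n) (a : W) : Ck k U (cst a).
Proof.
elim: k a => [|k IH] a; first by move=> x _; exact: cst_continuous.
split=> [x _|v]; first exact: differentiable_cst.
by under eq_fun do rewrite derive_cst; exact: IH.
Qed.

Lemma Ck_linear n W k (U : set 'rV[R]_n) (L : {linear 'rV[R]_n -> W}) :
  continuous L -> Ck k U L.
Proof.
move=> Lc; case: k => [|k]; first by move=> x _; exact: Lc.
split=> [x _|v]; first exact: linear_differentiable.
suff -> : (fun x => 'D_v L x) = cst (L v) by exact: Ck_cst.
by apply/funext => x; rewrite deriveE ?diff_lin //; exact: linear_differentiable.
Qed.

Lemma Ck_linear_comp n W W' k (U : set 'rV[R]_n) (f : 'rV[R]_n -> W)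
    (L : {linear W -> W'}) :
  continuous L -> open U -> Ck k U f -> Ck k U (L \o f).
Proof.
move=> Lc oU; elim: k f => [|k IH] f.
  move=> fc x Ux; apply: continuous_comp; [exact: fc|exact: Lc].
case=> df Df; split=> [x Ux|v].
  by apply: differentiable_comp; [exact: df|exact: linear_differentiable].
apply: Ck_ext (IH _ (Df v)) => // x Ux.
have dL y : differentiable L y by exact: linear_differentiable.
have dfx := df x Ux.
rewrite /= [RHS]deriveE; last exact: differentiable_comp.
by rewrite diff_comp //= diff_lin // deriveE.
Qed.

Lemma Ck_add n W k (U : set 'rV[R]_n) (f g : 'rV[R]_n -> W) :
  open U -> Ck k U f -> Ck k U g -> Ck k U (f + g).
Proof.
move=> oU; elim: k f g => [|k IH] f g.
  move=> fc gc x Ux; apply: continuousD; [exact: fc|exact: gc].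
case=> df Df [dg Dg]; split=> [x Ux|v].
  by apply: differentiableD; [exact: df|exact: dg].
apply: Ck_ext (IH _ _ (Df v) (Dg v)) => // x Ux.
rewrite [RHS]deriveD //; apply: diff_derivable; [exact: df|exact: dg].
Qed.

Lemma Ck_sum n W k (U : set 'rV[R]_n) p (f : 'I_p -> 'rV[R]_n -> W) :
  open U -> (forall i, Ck k U (f i)) -> Ck k U (\sum_i f i).
Proof.
move=> oU fk; elim/big_rec: _ => [|i g _ gk]; first exact: Ck_cst.
exact: Ck_add.
Qed.

Lemma Ck_mul n k (U : set 'rV[R]_n) (f g : 'rV[R]_n -> R) :
  open U -> Ck k U f -> Ck k U g -> Ck k U (f * g).
Proof.
move=> oU; elim: k f g => [|k IH] f g.
  move=> fc gc x Ux; apply: continuousM; [exact: fc|exact: gc].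
move=> fk gk; have [df Df] := fk; have [dg Dg] := gk.
split=> [x Ux|v].
  by apply: differentiableM; [exact: df|exact: dg].
have := Ck_add oU (IH _ _ (Ck_pred fk) (Dg v)) (IH _ _ (Ck_pred gk) (Df v)).
apply: Ck_ext => // x Ux.
rewrite [RHS]deriveM //; apply: diff_derivable; [exact: df|exact: dg].
Qed.

Definition coord_lin n (i : 'I_n) (v : 'rV[R]_n) : R := v 0 i.

Lemma coord_lin_linear n (i : 'I_n) : linear (@coord_lin n i).
Proof. by move=> a u v; rewrite /coord_lin !mxE. Qed.

HB.instance Definition _ n (i : 'I_n) :=
  GRing.isLinear.Build _ _ _ _ _ (@coord_lin_linear n i).

Definition inj_lin n (i : 'I_n) (a : R) : 'rV[R]_n := a *: delta_mx 0 i.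

Lemma inj_lin_linear n (i : 'I_n) : linear (@inj_lin n i).
Proof. by move=> a u v; rewrite /inj_lin scalerDl scalerA. Qed.

HB.instance Definition _ n (i : 'I_n) :=
  GRing.isLinear.Build _ _ _ _ _ (@inj_lin_linear n i).

Lemma Ck_coord n m k (U : set 'rV[R]_n) (f : 'rV[R]_n -> 'rV[R]_m) :
  open U -> Ck k U f <-> forall i, Ck k U (fun x => f x 0 i : R).
Proof.
move=> oU; split=> [fk i|fk].
  apply: (Ck_linear_comp (L := @coord_lin m i)) fk => //; exact: coord_continuous.
have -> : f = \sum_i (@inj_lin m i \o (fun x => f x 0 i)).
  apply/funext => x; rewrite fct_sumE; exact: row_sum_delta.
apply: Ck_sum => // i; apply: (Ck_linear_comp (L := @inj_lin m i)) => //.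
exact: scalel_continuous.
Qed.

Lemma Ck_comp n m p k (U : set 'rV[R]_n) (V : set 'rV[R]_m)
    (f : 'rV[R]_n -> 'rV[R]_m) (g : 'rV[R]_m -> 'rV[R]_p) :
  open U -> open V -> (forall x, U x -> V (f x)) ->
  Ck k U f -> Ck k V g -> Ck k U (g \o f).
Proof.
move=> oU oV UV; elim: k g => [|k IH] g.
  by move=> fc gc x Ux; apply: continuous_comp; [exact: fc|apply/gc/UV].
move=> fk [dg Dg]; have [df Df] := fk.
split=> [x Ux|v].
  by apply: differentiable_comp; [exact: df|apply/dg/UV].
apply/Ck_coord => // i.
have := @Ck_sum _ R k U m (fun j => (fun x => 'D_v f x 0 j) *
   (fun x => ('D_(delta_mx 0 j) g \o f) x 0 i)) oU.
have /[swap]/[apply] : forall j, Ck k U ((fun x => 'D_v f x 0 j) *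
   (fun x => ('D_(delta_mx 0 j) g \o f) x 0 i)).
  move=> j; apply: Ck_mul => //; first by move/Ck_coord : (Df v); exact.
  by have /Ck_coord := IH _ (Ck_pred fk) (Dg (delta_mx 0 j)); exact.
apply: Ck_ext => // x Ux.
have dfx := df x Ux; have dgx := dg _ (UV x Ux).
rewrite [in RHS]deriveE; last exact: differentiable_comp.
rewrite diff_comp //= -[in RHS](deriveE v) //.
rewrite [in RHS](row_sum_delta ('D_v f x)) linear_sum summxE fct_sumE.
by apply: eq_bigr => j _; rewrite linearZ mxE -deriveE.
Qed.

End Ck.

Record chart (R : realType) (n : nat) (M : topologicalType) := Chart {
  chart_dom : set M;
  chart_map :> M -> 'rV[R]_n;
  chart_inv : 'rV[R]_n -> M;
  chart_dom_open : open chart_dom;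
  chart_img_open : open (chart_map @` chart_dom);
  chart_mapK : forall x, chart_dom x -> chart_inv (chart_map x) = x;
  chart_map_continuous : forall x, chart_dom x -> {for x, continuous chart_map};
  chart_inv_continuous : forall v, (chart_map @` chart_dom) v ->
    {for v, continuous chart_inv}
}.

(* An atlas, not necessarily maximal, is part of the structure; the notions    *)
(* below do not change when it is replaced by a compatible one.                *)
HB.mixin Record isManifold (R : realType) M of Topological M := {
  mfd_dim : nat;
  atlas : set (chart R mfd_dim M);
  mfd_hausdorff : hausdorff_space M;
  mfd_second_countable : @second_countable M;
  atlas_cover : forall x : M, exists2 c, atlas c & chart_dom c x;
  atlas_compatible : forall c d, atlas c -> atlas d ->
    Cinfty (c @` (chart_dom c `&` chart_dom d)) (d \o chart_inv c)
}.

#[short(type="manifoldType")]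
HB.structure Definition Manifold (R : realType) :=
  {M of Topological M & isManifold R M}.

Arguments mfd_dim {R} s.
Arguments atlas_compatible {R s c d} _ _ k.

Section chart_lemmas.
Context {R : realType}.

Lemma open_preimage_in (T T' : topologicalType) (W : set T) (V : set T')
    (f : T -> T') :
  open W -> (forall x, W x -> {for x, continuous f}) -> open V ->
  open (W `&` f @^-1` V).
Proof.
move=> oW fc oV; rewrite openE => x [Wx Vfx].
apply: filterI; first exact: open_nbhs_nbhs.
by apply: (fc x Wx); exact: open_nbhs_nbhs.
Qed.

Lemma chart_image_open n (M : topologicalType) (c : chart R n M) (W : set M) :
  open W -> W `<=` chart_dom c -> open (c @` W).
Proof.
move=> oW Wc; suff -> : c @` W = (c @` chart_dom c) `&` chart_inv c @^-1` W.
  apply: open_preimage_in => //; first exact: chart_img_open.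
  exact: chart_inv_continuous.
apply/seteqP; split=> [_ [x Wx <-]|_ [[x cx <-]]] /=.
  by rewrite chart_mapK; [split => //; exists x => //|]; exact: Wc.
by rewrite chart_mapK // => Wx; exists x.
Qed.

Lemma pair_continuous (T T1 T2 : topologicalType) (f : T -> T1) (g : T -> T2) x :
  {for x, continuous f} -> {for x, continuous g} ->
  {for x, continuous (fun y => (f y, g y))}.
Proof. by move=> fc gc; apply: cvg_pair. Qed.

Lemma row_mx_continuous (T : topologicalType) m n (f : T -> 'rV[R]_m)
    (g : T -> 'rV[R]_n) x :
  {for x, continuous f} -> {for x, continuous g} ->
  {for x, continuous (fun y => row_mx (f y) (g y))}.
Proof.
move=> fc gc A [P nP PA].
have : \forall y \near x, forall i j, P i j (row_mx (f y) (g y) i j).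
  apply: filter_forall => i; apply: filter_forall => j.
  suff : continuous_at x (fun y => row_mx (f y) (g y) i j) by apply; exact: nP.
  under eq_fun do rewrite mxE.
  case: (fintype.split j) => k.
    exact: (continuous_comp fc (@coord_continuous R 1 m i k (f x))).
  exact: (continuous_comp gc (@coord_continuous R 1 n i k (g x))).
by apply: filterS => y; exact: PA.
Qed.

Lemma Ck_row_mx n m p k (U : set 'rV[R]_n) (f : 'rV[R]_n -> 'rV[R]_m)
    (g : 'rV[R]_n -> 'rV[R]_p) :
  open U -> Ck k U f -> Ck k U g -> Ck k U (fun x => row_mx (f x) (g x)).
Proof.
move=> oU /(Ck_coord _ _ oU) fk /(Ck_coord _ _ oU) gk; apply/Ck_coord => // i.
under eq_fun do rewrite mxE.
by case: (fintype.split i) => j; [exact: fk|exact: gk].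
Qed.

End chart_lemmas.

Lemma open_setX (S T : topologicalType) (A : set S) (B : set T) :
  open A -> open B -> open (A `*` B).
Proof.
move=> oA oB; rewrite openE => -[x y] [/= Ax By].
by exists (A, B) => //; split; exact: open_nbhs_nbhs.
Qed.

Section product.
Context {R : realType}.

Section prod_chart.
Variables (m n : nat) (M N : topologicalType) (c : chart R m M) (d : chart R n N).

Let map (p : M * N) : 'rV[R]_(m + n) := row_mx (c p.1) (d p.2).
Let inv (v : 'rV[R]_(m + n)) := (chart_inv c (lsubmx v), chart_inv d (rsubmx v)).
Let dom := chart_dom c `*` chart_dom d.

Lemma prod_chart_image (A : set M) (B : set N) :
  map @` (A `*` B) = lsubmx @^-1` (c @` A) `&` rsubmx @^-1` (d @` B).
Proof.
apply/seteqP; split=> [_ [[x y] /= [Ax By] <-]|v [/= [x Ax xv] [y By yv]]].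
  by rewrite /= row_mxKl row_mxKr; split; [exists x|exists y].
by exists (x, y) => //=; rewrite /map /= xv yv hsubmxK.
Qed.

Let dom_open : open dom.
Proof. by apply: open_setX; exact: chart_dom_open. Qed.

Let img_open : open (map @` dom).
Proof.
rewrite prod_chart_image; apply: openI; apply: open_comp => [v _|].
- exact: continuous_lsubmx.
- exact: chart_img_open.
- exact: continuous_rsubmx.
- exact: chart_img_open.
Qed.

Let mapK p : dom p -> inv (map p) = p.
Proof.
by case: p => x y [/= cx dy]; rewrite /inv row_mxKl row_mxKr !chart_mapK.
Qed.

Let map_continuous p : dom p -> {for p, continuous map}.
Proof.
move=> [cp dp]; apply: row_mx_continuous.
  by apply: continuous_comp; [exact: cvg_fst|exact: chart_map_continuous].
by apply: continuous_comp; [exact: cvg_snd|exact: chart_map_continuous].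
Qed.

Let inv_continuous v : (map @` dom) v -> {for v, continuous inv}.
Proof.
rewrite prod_chart_image => -[/= cv dv]; apply: pair_continuous.
  exact: (continuous_comp (@continuous_lsubmx R _ _ _ v)
    (chart_inv_continuous cv)).
exact: (continuous_comp (@continuous_rsubmx R _ _ _ v)
  (chart_inv_continuous dv)).
Qed.

Definition prod_chart : chart R (m + n) (M * N)%type :=
  Chart dom_open img_open mapK map_continuous inv_continuous.

End prod_chart.

Variables M N : manifoldType R.

Let prod_atlas : set (chart R (mfd_dim M + mfd_dim N) (M * N)%type) :=
  [set prod_chart c d | c in atlas & d in atlas].

Let nbhs_setX (x : M) (y : N) A B :
  nbhs x A -> nbhs y B -> nbhs (x, y) (A `*` B).
Proof. by move=> nA nB; exists (A, B). Qed.

Let prod_hausdorff : hausdorff_space (M * N)%type.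
Proof.
move=> [x y] [x' y'] h; congr (_, _).
  apply: mfd_hausdorff => A B nA nB.
  have [||[a b] []] := h (A `*` setT) (B `*` setT); last first.
  - by move=> [/= ? _] [/= ? _]; exists a.
  - by apply: nbhs_setX => //; exact: filterT.
  - by apply: nbhs_setX => //; exact: filterT.
apply: mfd_hausdorff => A B nA nB.
have [||[a b] []] := h (setT `*` A) (setT `*` B); last first.
- by move=> [/= _ ?] [/= _ ?]; exists b.
- by apply: nbhs_setX => //; exact: filterT.
- by apply: nbhs_setX => //; exact: filterT.
Qed.

Let prod_second_countable : @second_countable (M * N)%type.
Proof.
have [B cB [oB bB]] := @mfd_second_countable R M.
have [C cC [oC bC]] := @mfd_second_countable R N.
exists ((fun p => p.1 `*` p.2) @` (B `*` C)).
  exact: (card_le_trans (card_image_le _ _) (countableX cB cC)).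
split=> [_ [[b c] /= [Bb Cc] <-]|[x y] A [[A1 A2] /= [nA1 nA2] A12]].
  by apply: open_setX; [exact: oB|exact: oC].
have [b [Bb bx] bA] := bB x A1 nA1.
have [c [Cc cy] cA] := bC y A2 nA2.
exists (b `*` c); first by split => //; exists (b, c).
by move=> [u v] [/= bu cv]; apply: A12; split; [exact: bA|exact: cA].
Qed.

Let prod_cover (p : M * N) : exists2 c, prod_atlas c & chart_dom c p.
Proof.
have [c ac cp] := atlas_cover p.1; have [d ad dp] := atlas_cover p.2.
by exists (prod_chart c d) => //; exists c => //; exists d.
Qed.

Let prod_compatible c d : prod_atlas c -> prod_atlas d ->
  Cinfty (c @` (chart_dom c `&` chart_dom d)) (d \o chart_inv c).
Proof.
move=> [c1 ac1 [c2 ac2 <-]] [d1 ad1 [d2 ad2 <-]] k.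
have o1 : open (c1 @` (chart_dom c1 `&` chart_dom d1)).
  by apply: chart_image_open; [apply: openI; exact: chart_dom_open|move=> ? []].
have o2 : open (c2 @` (chart_dom c2 `&` chart_dom d2)).
  by apply: chart_image_open; [apply: openI; exact: chart_dom_open|move=> ? []].
rewrite [chart_dom _ `&` _](_ : _ = (chart_dom c1 `&` chart_dom d1) `*`
  (chart_dom c2 `&` chart_dom d2)); last first.
  by apply/seteqP; split=> -[x y] [[/= ? ?] [/= ? ?]].
rewrite prod_chart_image; set U := _ `&` _.
have oU : open U.
  by apply: openI; apply: open_comp => // v _;
    [exact: continuous_lsubmx|exact: continuous_rsubmx].
apply: Ck_row_mx => //.
  apply: (Ck_comp (f := lsubmx) (g := d1 \o chart_inv c1) oU o1) => [x []//||].
    by apply: Ck_linear; exact: continuous_lsubmx.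
  exact: atlas_compatible.
apply: (Ck_comp (f := rsubmx) (g := d2 \o chart_inv c2) oU o2) => [x []//||].
  by apply: Ck_linear; exact: continuous_rsubmx.
exact: atlas_compatible.
Qed.

HB.instance Definition _ := isManifold.Build R (M * N)%type
  prod_hausdorff prod_second_countable prod_cover prod_compatible.

End product.

Section smooth.
Context {R : realType}.
Implicit Types M N P : manifoldType R.

Definition smooth_in M N (W : set M) (f : M -> N) :=
  (forall x, W x -> {for x, continuous f}) /\
  (forall c d, atlas c -> atlas d ->
    Cinfty (c @` (W `&` chart_dom c `&` f @^-1` chart_dom d))
           (d \o f \o chart_inv c)).

Definition smooth M N (f : M -> N) := smooth_in setT f.

(* Smoothness on an arbitrary subset means local extendability to smooth maps *)
(* defined on open sets. When A is an embedded submanifold, as the fibre       *)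
(* product of two submersions is, this is smoothness for its induced           *)
(* structure.                                                                  *)
Definition smooth_on M N (A : set M) (f : M -> N) :=
  forall x, A x -> exists W, exists2 g : M -> N,
    [/\ open W, W x & smooth_in W g] & forall y, W y -> A y -> g y = f y.

Definition diffeomorphism M N (f : M -> N) :=
  smooth f /\ exists g : N -> M, [/\ smooth g, cancel f g & cancel g f].

Definition submersion M N (f : M -> N) :=
  smooth f /\ forall (x : M) c d, atlas c -> atlas d ->
    chart_dom c x -> chart_dom d (f x) ->
    forall w, exists v, 'd (d \o f \o chart_inv c) (c x) v = w.

Definition immersion M N (f : M -> N) :=
  smooth f /\ forall (x : M) c d, atlas c -> atlas d ->
    chart_dom c x -> chart_dom d (f x) ->
    injective ('d (d \o f \o chart_inv c) (c x)).

Definition surjective_submersion M N (f : M -> N) :=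
  submersion f /\ forall y, exists x, f x = y.

Definition embedding M N (f : M -> N) :=
  [/\ immersion f, injective f &
    forall U, open U -> exists2 V, open V & f @` U = range f `&` V].

Lemma chart_rep_dom_open M N (W : set M) (f : M -> N)
    (c : chart R (mfd_dim M) M) (V : set N) :
  open W -> (forall x, W x -> {for x, continuous f}) -> open V ->
  open (c @` (W `&` chart_dom c `&` f @^-1` V)).
Proof.
move=> oW fc oV; apply: chart_image_open => [|x [[]]//].
rewrite setIAC; apply: openI; last exact: chart_dom_open.
exact: open_preimage_in.
Qed.

Lemma smooth_in_local M N (W : set M) (f : M -> N) :
  open W -> (forall x, W x -> {for x, continuous f}) ->
  (forall x, W x -> exists c d, [/\ atlas c, atlas d, chart_dom c x,
    chart_dom d (f x) & exists V : set _, [/\ open V, V (c x) &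
      Cinfty V (d \o f \o chart_inv c)]]) ->
  smooth_in W f.
Proof.
move=> oW fc h; split=> // c' d' ac' ad' k.
apply: Ck_local => _ [x [[Wx c'x] d'x] <-].
have [c [d [ac ad cx dx [V [oV Vx fV]]]]] := h x Wx.
pose T := c' @` (((W `&` (f @^-1` (chart_dom d `&` chart_dom d'))) `&`
  (chart_dom c `&` c @^-1` V)) `&` chart_dom c').
have oT : open T.
  apply: chart_image_open => [|? []//].
  apply: openI; last exact: chart_dom_open.
  apply: openI.
    by apply: open_preimage_in => //; apply: openI; exact: chart_dom_open.
  apply: open_preimage_in => //; first exact: chart_dom_open.
  exact: chart_map_continuous.
exists T; first by exists x.
have oV' : open (V `&` c @` (W `&` chart_dom c `&`
    f @^-1` (chart_dom d `&` chart_dom d'))).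
  apply: openI => //; apply: chart_rep_dom_open => //.
  by apply: openI; exact: chart_dom_open.
have h1 : Ck k T (c \o chart_inv c').
  apply: (Ck_sub _ (atlas_compatible ac' ac k)) => _ [y [[_ [cy _]] c'y] <-].
  by exists y.
have h2 : Ck k (V `&` c @` (W `&` chart_dom c `&`
    f @^-1` (chart_dom d `&` chart_dom d'))) (d \o f \o chart_inv c).
  by apply: (Ck_sub _ (fV k)) => ? [].
have od : open (d @` (chart_dom d `&` chart_dom d')).
  by apply: chart_image_open => [|? []//]; apply: openI; exact: chart_dom_open.
have h4 : Ck k (V `&` c @` (W `&` chart_dom c `&`
    f @^-1` (chart_dom d `&` chart_dom d')))
    ((d' \o chart_inv d) \o (d \o f \o chart_inv c)).
  apply: (Ck_comp oV' od) h2 (atlas_compatible ad ad' k).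
  move=> _ [_ [y [[Wy cy] [dy d'y]] <-]] /=.
  by rewrite chart_mapK //; exists (f y).
have h5 := Ck_comp oT oV' _ h1 h4.
apply: Ck_ext (h5 _) => // _ [y [[[Wy [dy d'y]] [cy Vy]] c'y] <-] /=.
  by rewrite !chart_mapK.
by rewrite chart_mapK //; split => //; exists y.
Qed.

Lemma smooth_in_comp M N P (W : set M) (V : set N) (f : M -> N) (g : N -> P) :
  open W -> open V -> (forall x, W x -> V (f x)) ->
  smooth_in W f -> smooth_in V g -> smooth_in W (g \o f).
Proof.
move=> oW oV WV [fc fk] [gc gk].
have gfc x : W x -> {for x, continuous (g \o f)}.
  by move=> Wx; apply: continuous_comp; [exact: fc|apply/gc/WV].
apply: smooth_in_local => // x Wx.
have [c ac cx] := atlas_cover x; have [e ae ex] := atlas_cover (f x).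
have [d ad dx] := atlas_cover (g (f x)).
exists c, d; split => //.
pose S := chart_dom e `&` (V `&` g @^-1` chart_dom d).
have oS : open S.
  apply: openI; first exact: chart_dom_open.
  by apply: open_preimage_in => //; exact: chart_dom_open.
exists (c @` (W `&` chart_dom c `&` f @^-1` S)); split.
- exact: chart_rep_dom_open.
- by exists x => //; do !split => //; exact: WV.
move=> k.
have o1 : open (c @` (W `&` chart_dom c `&` f @^-1` S)).
  exact: chart_rep_dom_open.
have o2 : open (e @` (V `&` chart_dom e `&` g @^-1` chart_dom d)).
  by apply: chart_rep_dom_open => //; exact: chart_dom_open.
have h1 : Ck k (c @` (W `&` chart_dom c `&` f @^-1` S)) (e \o f \o chart_inv c).
  apply: (Ck_sub _ (fk c e ac ae k)) => _ [y [[Wy cy] [ey _]] <-].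
  by exists y.
have h3 := Ck_comp o1 o2 _ h1 (gk e d ae ad k).
apply: Ck_ext (h3 _) => // _ [y [[Wy cy] [ey [Vy dy]]] <-] /=.
  by rewrite chart_mapK // chart_mapK.
by rewrite chart_mapK //; exists (f y).
Qed.

Lemma smooth_comp M N P (f : M -> N) (g : N -> P) :
  smooth f -> smooth g -> smooth (g \o f).
Proof. exact: (smooth_in_comp openT openT). Qed.

Lemma smooth_pair M N P (f : P -> M) (g : P -> N) :
  smooth f -> smooth g -> smooth (fun x => (f x, g x)).
Proof.
move=> [fc fk] [gc gk].
have pc x : setT x -> {for x, continuous (fun x => (f x, g x))}.
  by move=> _; apply: pair_continuous; [exact: fc|exact: gc].
apply: smooth_in_local => [|//|x _]; first exact: openT.
have [c ac cx] := atlas_cover x; have [d ad dx] := atlas_cover (f x).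
have [e ae ex] := atlas_cover (g x).
exists c, (prod_chart d e); split => //; first by exists d => //; exists e.
pose O1 := c @` (setT `&` chart_dom c `&` f @^-1` chart_dom d).
pose O2 := c @` (setT `&` chart_dom c `&` g @^-1` chart_dom e).
have oO1 : open O1.
  by apply: chart_rep_dom_open => //; [exact: openT|exact: chart_dom_open].
have oO2 : open O2.
  by apply: chart_rep_dom_open => //; [exact: openT|exact: chart_dom_open].
exists (O1 `&` O2); split; [exact: openI|by split; exists x|].
move=> k; apply: Ck_row_mx; first exact: openI.
  by apply: (Ck_sub _ (fk c d ac ad k)) => ? [].
by apply: (Ck_sub _ (gk c e ac ae k)) => ? [].
Qed.

Lemma smooth_cst M N (a : N) : smooth (cst a : M -> N).
Proof.
split=> [x _|c d ac ad k]; first exact: cst_continuous.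
exact: (@Ck_cst R _ _ k _ (d a)).
Qed.

Lemma smooth_id M : smooth (@idfun M).
Proof. by split=> [x _ //|c d ac ad k]; rewrite setTI; exact: atlas_compatible. Qed.

Lemma smooth_fst M N : smooth (fst : M * N -> M).
Proof.
apply: smooth_in_local => [|x _|x _]; [exact: openT|exact: cvg_fst|].
have [c ac cx] := atlas_cover x.1; have [e ae ex] := atlas_cover x.2.
exists (prod_chart c e), c; split => //; first by exists c => //; exists e.
have oU : open (prod_chart c e @` chart_dom (prod_chart c e)).
  exact: chart_img_open.
exists (prod_chart c e @` chart_dom (prod_chart c e)); split => //.
  by exists x.
move=> k; apply: (Ck_ext oU _ (Ck_linear (L := lsubmx) _ _ _)).
  move=> _ [y [cy ey] <-] /=; by rewrite row_mxKl chart_mapK.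
exact: continuous_lsubmx.
Qed.

Lemma smooth_snd M N : smooth (snd : M * N -> N).
Proof.
apply: smooth_in_local => [|x _|x _]; [exact: openT|exact: cvg_snd|].
have [c ac cx] := atlas_cover x.1; have [e ae ex] := atlas_cover x.2.
exists (prod_chart c e), e; split => //; first by exists c => //; exists e.
have oU : open (prod_chart c e @` chart_dom (prod_chart c e)).
  exact: chart_img_open.
exists (prod_chart c e @` chart_dom (prod_chart c e)); split => //.
  by exists x.
move=> k; apply: (Ck_ext oU _ (Ck_linear (L := rsubmx) _ _ _)).
  move=> _ [y [cy ey] <-] /=; by rewrite row_mxKr chart_mapK.
exact: continuous_rsubmx.
Qed.

Lemma smooth_smooth_on M N (A : set M) (f : M -> N) : smooth f -> smooth_on A f.
Proof. by move=> fs x Ax; exists setT, f => //; split => //; exact: openT. Qed.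

Lemma submersion_local_section M N (f : M -> N) : smooth f ->
  (forall x, exists V, exists s : N -> M,
    [/\ open V, V (f x), smooth_in V s, s (f x) = x &
      forall y, V y -> f (s y) = y]) -> submersion f.
Proof.
move=> fs h; split=> // x c d ac ad cx dx w.
have [V [s [oV Vx [sc sk] sx fsV]]] := h x; have [fc fk] := fs.
have o1 : open (c @` (setT `&` chart_dom c `&` f @^-1` chart_dom d)).
  by apply: chart_rep_dom_open => //; [exact: openT|exact: chart_dom_open].
have o2 : open (d @` (V `&` chart_dom d `&` s @^-1` chart_dom c)).
  by apply: chart_rep_dom_open => //; exact: chart_dom_open.
have I2 : (d @` (V `&` chart_dom d `&` s @^-1` chart_dom c)) (d (f x)).
  by exists (f x) => //; split => //=; rewrite sx.
have dF : differentiable (d \o f \o chart_inv c) (c x).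
  by have [+ _] := fk c d ac ad 1%N; apply; exists x.
have dS : differentiable (c \o s \o chart_inv d) (d (f x)).
  by have [+ _] := sk d c ad ac 1%N; apply.
have Sx : (c \o s \o chart_inv d) (d (f x)) = c x by rewrite /= chart_mapK // sx.
have e : \forall v \near d (f x),
    v = (d \o f \o chart_inv c) ((c \o s \o chart_inv d) v).
  apply: filterS (open_nbhs_nbhs (conj o2 I2)) => _ [y [[Vy dy] cy] <-] /=.
  by rewrite (chart_mapK dy) (chart_mapK cy) fsV.
exists ('d (c \o s \o chart_inv d) (d (f x)) w).
exact: diff_right_inverse dS dF Sx e w.
Qed.

Lemma submersion_fst M N : submersion (fst : M * N -> M).
Proof.
apply: submersion_local_section; first exact: smooth_fst.
move=> [x y]; exists setT, (fun z => (z, y)); split => //; first exact: openT.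
exact: (@smooth_pair M N M idfun (cst y) (@smooth_id M) (@smooth_cst M N y)).
Qed.

End smooth.

HB.mixin Record isLieGroup (R : realType) G of Manifold R G & Group G := {
  mulg_smooth : smooth (fun p : G * G => (p.1 * p.2)%g : G);
  invg_smooth : smooth (fun x : G => x^-1%g)
}.

#[short(type="lieGroupType")]
HB.structure Definition LieGroup (R : realType) :=
  {G of Manifold R G & Group G & isLieGroup R G}.

(* [gcomp g f] is the composite "g after f"; it is a total function, and its   *)
(* values are constrained only when [gtgt f = gsrc g].                         *)
Record lieGroupoid (R : realType) (X0 : manifoldType R) := LieGroupoid {
  arrow :> manifoldType R;
  gsrc : arrow -> X0;
  gtgt : arrow -> X0;
  gunit : X0 -> arrow;
  ginv : arrow -> arrow;
  gcomp : arrow -> arrow -> arrow;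
  gsrc_submersion : surjective_submersion gsrc;
  gtgt_submersion : surjective_submersion gtgt;
  gunit_smooth : smooth gunit;
  ginv_smooth : smooth ginv;
  gcomp_smooth : smooth_on [set p : arrow * arrow | gtgt p.2 = gsrc p.1]
                           (fun p => gcomp p.1 p.2);
  gsrc_unit : forall x, gsrc (gunit x) = x;
  gtgt_unit : forall x, gtgt (gunit x) = x;
  gsrc_comp : forall g f, gtgt f = gsrc g -> gsrc (gcomp g f) = gsrc f;
  gtgt_comp : forall g f, gtgt f = gsrc g -> gtgt (gcomp g f) = gtgt g;
  gcompA : forall h g f, gtgt f = gsrc g -> gtgt g = gsrc h ->
    gcomp h (gcomp g f) = gcomp (gcomp h g) f;
  gcompf1 : forall f, gcomp f (gunit (gsrc f)) = f;
  gcomp1f : forall f, gcomp (gunit (gtgt f)) f = f;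
  gsrc_inv : forall f, gsrc (ginv f) = gtgt f;
  gtgt_inv : forall f, gtgt (ginv f) = gsrc f;
  gcompVg : forall f, gcomp (ginv f) f = gunit (gsrc f);
  gcompgV : forall f, gcomp f (ginv f) = gunit (gtgt f)
}.

Definition is_gunit (R : realType) (X0 : manifoldType R) (X : lieGroupoid X0)
  (f : X) := exists x, f = gunit X x.

Record lie_groupoid_morphism (R : realType) (X0 Y0 : manifoldType R)
    (X : lieGroupoid X0) (Y : lieGroupoid Y0) (f0 : X0 -> Y0) (f1 : X -> Y)
    : Prop := LieGroupoidMorphism {
  morphism_smooth0 : smooth f0;
  morphism_smooth1 : smooth f1;
  morphism_src : forall f, gsrc (f1 f) = f0 (gsrc f);
  morphism_tgt : forall f, gtgt (f1 f) = f0 (gtgt f);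
  morphism_unit : forall x, f1 (gunit X x) = gunit Y (f0 x);
  morphism_comp : forall g f, gtgt f = gsrc g ->
    f1 (gcomp g f) = gcomp (f1 g) (f1 f)
}.

Section group_bundle.
Variables (R : realType) (M : manifoldType R) (G : lieGroupType R).

Let src_submersion : surjective_submersion (fst : M * G -> M).
Proof. by split; [exact: submersion_fst|move=> x; exists (x, 1%g)]. Qed.

Let unit_smooth : smooth (fun m : M => (m, 1%g : G)).
Proof. exact: (@smooth_pair R M G M idfun (cst 1%g) (@smooth_id R M) (@smooth_cst R M G _)). Qed.

Let inv_smooth : smooth (fun p : M * G => (p.1, p.2^-1%g)).
Proof.
apply: smooth_pair; first exact: smooth_fst.
exact: smooth_comp (@smooth_snd R M G) (@invg_smooth R G).
Qed.

Let comp_smooth :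
  smooth_on [set p : (M * G) * (M * G) | p.2.1 = p.1.1]
    (fun p => (p.2.1, (p.1.2 * p.2.2)%g)).
Proof.
apply: smooth_smooth_on; apply: smooth_pair.
  exact: smooth_comp (@smooth_snd R _ _) (@smooth_fst R _ _).
apply: (smooth_comp (f := fun p : (M * G) * (M * G) => (p.1.2, p.2.2))
  (g := fun p : G * G => (p.1 * p.2)%g)); last exact: mulg_smooth.
apply: smooth_pair.
  exact: smooth_comp (@smooth_fst R _ _) (@smooth_snd R _ _).
exact: smooth_comp (@smooth_snd R _ _) (@smooth_snd R _ _).
Qed.

Let compA (r q p : M * G) : p.1 = q.1 -> q.1 = r.1 ->
  (p.1, (r.2 * (q.2 * p.2))%g) = (p.1, ((r.2 * q.2) * p.2)%g).
Proof. by rewrite mulgA. Qed.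

Let compf1 (p : M * G) : (p.1, (p.2 * 1)%g) = p.
Proof. by case: p => m g; rewrite mulg1. Qed.

Let comp1f (p : M * G) : (p.1, (1 * p.2)%g) = p.
Proof. by case: p => m g; rewrite mul1g. Qed.

Let compVg (p : M * G) : (p.1, (p.2^-1 * p.2)%g) = (p.1, 1%g).
Proof. by rewrite mulVg. Qed.

Let compgV (p : M * G) : (p.1, (p.2 * p.2^-1)%g) = (p.1, 1%g).
Proof. by rewrite mulgV. Qed.

Definition group_bundle : lieGroupoid M :=
  @LieGroupoid R M (M * G)%type
    fst fst (fun m => (m, 1%g)) (fun p => (p.1, p.2^-1%g))
    (fun p q => (q.1, (p.2 * q.2)%g))
    src_submersion src_submersion unit_smooth inv_smooth comp_smooth
    (fun=> erefl) (fun=> erefl) (fun _ _ _ => erefl) (fun _ _ e => e)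
    compA compf1 comp1f (fun=> erefl) (fun=> erefl) compVg compgV.

End group_bundle.

Record lie_groupoid_extension (R : realType) (M : manifoldType R)
    (G : lieGroupType R) (Gamma2 Gamma1 : lieGroupoid M)
    (i : group_bundle M G -> Gamma2) (phi : Gamma2 -> Gamma1) : Prop :=
  LieGroupoidExtension {
  extension_inj_morphism : lie_groupoid_morphism idfun i;
  extension_proj_morphism : lie_groupoid_morphism idfun phi;
  extension_embedding : embedding i;
  extension_submersion : surjective_submersion phi;
  extension_exact : range i = [set f | is_gunit (phi f)]
}.

Record smooth_right_action (R : realType) (P : manifoldType R)
    (G : lieGroupType R) (act : P * G -> P) : Prop := SmoothRightAction {
  action_smooth : smooth act;
  action1 : forall p, act (p, 1%g) = p;
  actionM : forall p g h, act (p, (g * h)%g) = act (act (p, g), h)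
}.

(* [triv] is a G-equivariant diffeomorphism from pi^-1(U) to U x G over U,     *)
(* with inverse [triv'].                                                       *)
Definition local_trivialization (R : realType) (P B : manifoldType R)
    (G : lieGroupType R) (pi : P -> B) (act : P * G -> P) (U : set B)
    (triv : P -> B * G) (triv' : B * G -> P) : Prop :=
  [/\ smooth_in (pi @^-1` U) triv, smooth_in (U `*` setT) triv',
    forall p, U (pi p) -> (triv p).1 = pi p /\ triv' (triv p) = p,
    forall q, U q.1 -> pi (triv' q) = q.1 /\ triv (triv' q) = q &
    forall p g, U (pi p) -> triv (act (p, g)) = ((triv p).1, ((triv p).2 * g)%g)].

Record principal_bundle (R : realType) (P B : manifoldType R)
    (G : lieGroupType R) (pi : P -> B) (act : P * G -> P) : Prop :=
  PrincipalBundle {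
  principal_proj_smooth : smooth pi;
  principal_action : smooth_right_action act;
  principal_fiber : forall p g, pi (act (p, g)) = pi p;
  principal_trivial : forall b, exists U, exists triv, exists triv',
    [/\ open U, U b & local_trivialization pi act U triv triv']
}.

Section twisted.
Variables (R : realType) (G : lieGroupType R).

Record twisting_map (E0 : manifoldType R) (E : lieGroupoid E0)
    (eta : E * G -> E) : Prop := TwistingMap {
  twisting_smooth : smooth eta;
  twisting_src : forall f k, gsrc (eta (f, k)) = gsrc f;
  twisting_tgt : forall f k, gtgt (eta (f, k)) = gtgt f;
  twisting_comp : forall g f k, gtgt f = gsrc g ->
    eta (gcomp g f, k) = gcomp (eta (g, k)) (eta (f, k));
  twisting_unit : forall x k, eta (gunit E x, k) = gunit E x;
  twistingM : forall f k2 k1, eta (f, (k2 * k1)%g) = eta (eta (f, k1), k2);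
  twisting1 : forall f, eta (f, 1%g) = f
}.

(* The last four fields say that the action, together with the identity on     *)
(* objects, is a functor to E from the semidirect product of E and [G => e]    *)
(* along eta, where (g, k2) after (f, k1) is (g after eta (f, k2), k2 k1).     *)
Record twisted_action (E0 : manifoldType R) (E : lieGroupoid E0)
    (eta act : E * G -> E) : Prop := TwistedAction {
  twisted_right_action : smooth_right_action act;
  twisted_action_src : forall f k, gsrc (act (f, k)) = gsrc f;
  twisted_action_tgt : forall f k, gtgt (act (f, k)) = gtgt f;
  twisted_action_unit : forall x, act (gunit E x, 1%g) = gunit E x;
  twisted_action_comp : forall g f k2 k1, gtgt f = gsrc g ->
    gcomp (act (g, k2)) (act (f, k1)) =
    act (gcomp g (eta (f, k2)), (k2 * k1)%g)
}.

Record twisted_principal_bundle (E0 X0 : manifoldType R) (E : lieGroupoid E0)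
    (X : lieGroupoid X0) (pi0 : E0 -> X0) (pi1 : E -> X)
    (eta act : E * G -> E) : Prop := TwistedPrincipalBundle {
  twisted_morphism : lie_groupoid_morphism pi0 pi1;
  twisted_twisting : twisting_map eta;
  twisted_twisted_action : twisted_action eta act;
  twisted_objects : diffeomorphism pi0;
  twisted_principal : principal_bundle pi1 act
}.

End twisted.

(* Main.v *)
(* (1) Over a neighbourhood of a unit, a trivialization [h] of the principal
   bundle gives the map [f |-> (s f, h(1_(s f))^-1 h(f))], a smooth local left
   inverse of [i]; hence [i] is an embedding.  Exactness is the transitivity of
   [G] on the fibres of [pi1].
   (2) A smooth local section [s] of [phi] gives the trivialization
   [f |-> (phi f, i^-1(s(phi f)^-1 o f))].  The section exists because [phi] is a
   submersion, and [i^-1] is smooth on the range because an immersion has smooth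
   local left inverses.  In charts, composing with a linear one-sided inverse of
   the derivative reduces both facts to the inverse function theorem for a map
   whose derivative at the base point is the identity; there, [id - F] is a
   contraction for the sup norm and Banach's fixed point theorem applies. *)
Require Import Defs.
From mathcomp Require Import all_boot all_order all_algebra.
From mathcomp Require Import boolp classical_sets functions reals topology.
From mathcomp Require Import interval_inference normedtype landau.
From mathcomp Require Import sequences derive.
From mathcomp Require Import ring lra.

Import Order.TTheory GRing.Theory Num.Theory.
Import numFieldNormedType.Exports.

Set Implicit Arguments.
Unset Strict Implicit.

(** * The inverse function theorem *)

Section calculus.
Local Open Scope classical_set_scope.
Local Open Scope ring_scope.
Context {R : realType}.
Implicit Types n m k : nat.

Lemma coord_le_norm n (v : 'rV[R]_n) i : `|v 0 i| <= `|v|.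
Proof.
rewrite [leRHS]/Num.Def.normr/= mx_normrE.
exact: (le_bigmax _ (fun ij => `|v ij.1 ij.2|) (0, i)).
Qed.

Lemma norm_le_coord n (v : 'rV[R]_n) e :
  0 <= e -> (forall i, `|v 0 i| <= e) -> `|v| <= e.
Proof.
move=> e0 h; rewrite [leLHS]/Num.Def.normr/= mx_normrE.
by apply: bigmax_le => // -[i j] _ /=; rewrite (ord1 i).
Qed.

(** The norm is the sup norm, so each coordinate can be bounded separately, and a coordinate of [f]
    along the segment from [y] to [x] is a real function subject to the one-variable mean value
    theorem. Convexity of the ball keeps the segment inside it. *)
Lemma mean_value_ineq n m (f : 'rV[R]_n -> 'rV[R]_m) (x0 : 'rV[R]_n)
    (r q : R) : 0 <= q ->
  (forall x : 'rV[R]_n, `|x - x0| < r -> differentiable f x) ->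
  (forall x : 'rV[R]_n, `|x - x0| < r -> forall v, `|'d f x v| <= q * `|v|) ->
  forall x y : 'rV[R]_n, `|x - x0| < r -> `|y - x0| < r ->
    `|f x - f y| <= q * `|x - y|.
Proof.
move=> q0 df dq x y xr yr; apply: norm_le_coord => [|i].
  by rewrite mulr_ge0.
pose p (t : R) := t *: (x - y) + y.
have pr (t : R) : t \in `[0, 1]%R -> `|p t - x0| < r.
  rewrite in_itv /= => /andP[t0 t1].
  have -> : p t - x0 = t *: (x - x0) + (1 - t) *: (y - x0).
    by apply/rowP => j; rewrite !mxE; ring.
  apply: le_lt_trans (ler_normD _ _) _; rewrite !normrZ.
  rewrite (ger0_norm t0) ger0_norm ?subr_ge0 //.
  (* For [t > 0] the strict inequality comes from the [x] term; at [t = 0] that term vanishes and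
     the [y] term must supply it. *)
  have [t00|t0'] := eqVneq t 0; first by rewrite t00 mul0r subr0 mul1r add0r.
  have tpos : 0 < t by rewrite lt_neqAle eq_sym t0'.
  have := ltr_pM2l tpos `|x - x0| r; rewrite xr => h1.
  have h2 : (1 - t) * `|y - x0| <= (1 - t) * r.
    by apply: ler_wpM2l; [rewrite subr_ge0|exact: ltW].
  lra.
pose g (t : R) : R := f (p t) 0 i.
have dp (t : R) : is_diff t p (fun s : R => s *: (x - y)).
  have -> : (fun s : R => s *: (x - y)) = (fun s : R => s *: (x - y)) + 0.
    by rewrite addr0.
  exact: is_diffD.
have dg (t : R) : t \in `[0, 1]%R ->
    is_derive t (1 : R) g ('d f (p t) (x - y) 0 i).
  move=> t01.
  have df' := df _ (pr _ t01).
  have dfp : differentiable (f \o p) t by apply: differentiable_comp.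
  have dc : differentiable (coord_lin i) (f (p t)).
    by apply: linear_differentiable; exact: coord_continuous.
  have dgt : differentiable (coord_lin i \o (f \o p)) t.
    by apply: differentiable_comp.
  apply: DeriveDef; first exact: diff_derivable.
  rewrite deriveE // (diff_comp dfp dc) /= (diff_comp _ df') //= diff_val scale1r.
  by rewrite diff_lin //; exact: coord_continuous.
have gc : {within `[0, 1], continuous g}.
  apply: derivable_within_continuous => t t01.
  exact: (@ex_derive _ _ _ _ _ _ _ (dg t t01)).
have [c c01 e] := @MVT R g (fun t => 'd f (p t) (x - y) 0 i) 0 1 ltr01
  (fun t h => dg t (subset_itv_oo_cc h)) gc.
have -> : (f x - f y) 0 i = 'd f (p c) (x - y) 0 i.
  move: e; rewrite subr0 mulr1 => <-.
  by rewrite /g /p scale1r subrK scale0r add0r !mxE.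
apply: le_trans (coord_le_norm _ _) _; apply: dq; apply: pr.
exact: subset_itv_oo_cc.
Qed.

(** The directional derivatives along the [n] basis vectors are continuous, so near [x0] each is
    within [1/(2n)] of its basis vector. Expanding [v] in the basis and summing [n] such errors
    gives the factor 1/2. *)
Lemma derive_near_id n (U : set 'rV[R]_n) (F : 'rV[R]_n -> 'rV[R]_n)
    (x0 : 'rV[R]_n) :
  open U -> U x0 -> Ck 1 U F -> (forall v, 'd F x0 v = v) ->
  exists2 r, 0 < r & forall x : 'rV[R]_n, `|x - x0| < r ->
    U x /\ forall v, `|v - 'd F x v| <= 2^-1 * `|v|.
Proof.
move=> oU Ux0 [dF cF] Fid.
have cj (j : 'I_n) : \forall x \near x0,
    `|delta_mx 0 j - 'D_(delta_mx 0 j) F x| <= (2 * n%:R)^-1.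
  have := cF (delta_mx 0 j) x0 Ux0.
  rewrite /prop_for /continuous_at deriveE; last exact: dF.
  rewrite Fid => /cvgrPdist_le; apply.
  (* The index [j : 'I_n] excludes [n = 0]. *)
  by rewrite invr_gt0 mulr_gt0 // ltr0n; case: (n) j => // -[].
have {}cj : \forall x \near x0, forall j : 'I_n,
    `|delta_mx 0 j - 'D_(delta_mx 0 j) F x| <= (2 * n%:R)^-1.
  by apply: filter_forall cj.
have /(@nbhs_ballP R 'rV[R]_n) [r r0 h] :
    \forall x \near x0, U x /\ forall j : 'I_n,
      `|delta_mx 0 j - 'D_(delta_mx 0 j) F x| <= (2 * n%:R)^-1.
  exact: filterI (open_nbhs_nbhs (conj oU Ux0)) cj.
 exists r => // x xr.
have [|Ux hx] := h x; first by rewrite -ball_normE /= distrC.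
split=> // v.
have -> : v - 'd F x v =
    \sum_j v 0 j *: (delta_mx 0 j - 'D_(delta_mx 0 j) F x).
  rewrite {1 2}(row_sum_delta v) linear_sum -sumrB; apply: eq_bigr => j _.
  by rewrite linearZ scalerBr deriveE //; exact: dF.
apply: le_trans (ler_norm_sum _ _ _) _.
apply: (@le_trans _ _ (\sum_(j < n) `|v| * (2 * n%:R)^-1)).
  by apply: ler_sum => j _; rewrite normrZ ler_pM // coord_le_norm.
rewrite sumr_const card_ord -[leLHS]mulr_natr -mulrA [leRHS]mulrC.
apply: ler_wpM2l => //.
have [-> |n0] := eqVneq (n%:R : R) 0; first by rewrite mulr0 invr_ge0.
by rewrite invfM mulfVK.
Qed.

(** The sum of the norms of the images of the basis vectors bounds the operator. *)
Lemma linear_rV_continuous n (W : normedModType R) (f : {linear 'rV[R]_n -> W}) :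
  continuous f.
Proof.
apply: bounded_linear_continuous; apply/linear_boundedP.
near=> r => x; rewrite {1}(row_sum_delta x) linear_sum.
apply: (@le_trans _ _ ((\sum_(j < n) `|f (delta_mx 0 j)|) * `|x|)).
  rewrite mulr_suml; apply: le_trans (ler_norm_sum _ _ _) _.
  apply: ler_sum => j _; rewrite linearZ normrZ mulrC.
  by apply: ler_wpM2l => //; exact: coord_le_norm.
apply: ler_wpM2r => //; near: r; apply: nbhs_pinfty_ge.
Unshelve. all: by end_near. Qed.

(** Together with [near_diff], this trades the little-o form of differentiability for the explicit
    estimate in which [diff_inverse] is proved. *)
Lemma diff_of_near n m (f : 'rV[R]_n -> 'rV[R]_m) (x : 'rV[R]_n)
    (L : {linear 'rV[R]_n -> 'rV[R]_m}) :
  (forall e : R, 0 < e ->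
    \forall y \near x, `|f y - f x - L (y - x)| <= e * `|y - x|) ->
  differentiable f x /\ 'd f x = L :> (_ -> _).
Proof.
move=> h.
have Lc : continuous L by exact: linear_rV_continuous.
have e : f \o shift x = cst (f x) + L +o_ (0 : 'rV[R]_n) id.
  apply/eqaddoP => e e0.
  have : \forall y \near (0 : 'rV[R]_n),
      `|f (y + x) - f x - L (y + x - x)| <= e * `|y + x - x|.
    rewrite (near_shift x) sub0r; apply: filterS (h e e0) => y /=.
    by rewrite subrK.
  apply: filterS => y; rewrite addrK !fctE /=.
  by rewrite opprD addrA.
have d : 'd f x = L :> (_ -> _) by exact/diff_unique.
by split => //; apply/diff_locallyP; rewrite d.
Qed.

Lemma near_diff n m (f : 'rV[R]_n -> 'rV[R]_m) (x : 'rV[R]_n) (e : R) :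
  differentiable f x -> 0 < e ->
  \forall y \near x, `|f y - f x - 'd f x (y - x)| <= e * `|y - x|.
Proof.
move=> df e0.
have [_ /eqaddoP/(_ e e0)] := (diff_locallyP x f).1 df.
rewrite [X in X -> _](near_shift x) sub0r.
by apply: filterS => y /=; rewrite !fctE /= opprD addrA subrK.
Qed.

(** The lower bound on the derivative [A] of [F] makes [A] invertible. Applied to the error
    [G z - G y - (z - y) A^-1], whose image under [A] is up to sign the Taylor remainder of [F] at
    [G y], it makes that error small relative to [G z - G y], hence to [z - y]. *)
Lemma diff_inverse n (F G : 'rV[R]_n -> 'rV[R]_n) (y : 'rV[R]_n) :
  differentiable F (G y) -> (forall v, `|v| <= 2 * `|'d F (G y) v|) ->
  {for y, continuous G} ->
  (\forall z \near y, F (G z) = z /\ `|G z - G y| <= 2 * `|z - y|) ->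
  'J F (G y) \in unitmx /\ differentiable G y /\
    forall v, 'd G y v = v *m invmx ('J F (G y)).
Proof.
move=> dF Finj Gc hG; set A := 'J F (G y).
have FA v : 'd F (G y) v = v *m A by rewrite mul_rV_lin1.
have uA : A \in unitmx.
  rewrite -row_free_unit -kermx_eq0; apply/rowV0P => v /sub_kermxP vA.
  apply/normr0_eq0/le_anti; rewrite normr_ge0 -(mulr0 2).
  by rewrite -[in leRHS](@normr0 _ 'rV[R]_n) -vA -FA Finj.
split; first exact: uA.
have [] := @diff_of_near n n G y (mulmxr (invmx A)).
  (* One factor 2 is lost to the lower bound on the derivative and another to the Lipschitz bound on
     [G]. *)
  move=> e e0; have e4 : 0 < e / 4 by rewrite divr_gt0.
  have h : \forall z \near y,
      `|F (G z) - F (G y) - 'd F (G y) (G z - G y)| <= e / 4 * `|G z - G y|.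
    exact: (Gc _ (near_diff dF e4)).
  near=> z.
  have [zE zl] : F (G z) = z /\ `|G z - G y| <= 2 * `|z - y| by near: z.
  have FGy : F (G y) = y by have [] := nbhs_singleton hG.
  have := Finj (G z - G y - (z - y) *m invmx A).
  rewrite FA [_ *m A]mulmxBl mulmxKV // -FA => /le_trans; apply.
  have : `|F (G z) - F (G y) - 'd F (G y) (G z - G y)| <= e / 4 * `|G z - G y|.
    by near: z.
  rewrite zE FGy distrC => /(ler_wpM2l (ler0n R 2)) /le_trans; apply.
  have := ler_wpM2l (ltW e4) zl; lra.
by move=> dG dGE; split; [exact: dG|move=> v; rewrite dGE].
Unshelve. all: by end_near. Qed.

(** Joins the normed module and completeness structures of row vectors into the type that
    [banach_fixed_point] expects. *)
Definition rV_completeNormedModType n : completeNormedModType R :=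
  CompleteNormedModule.Pack (CompleteNormedModule.Class
    (NormedModule.on 'rV[R]_n) (Complete.on 'rV[R]_n)).

(** * Maps whose derivative stays close to the identity on a ball *)

Section near_identity.
Variables (n : nat) (F : 'rV[R]_n -> 'rV[R]_n) (x0 : 'rV[R]_n) (r : R).
Hypothesis r0 : 0 < r.
Hypothesis dF : forall x : 'rV[R]_n, `|x - x0| < r -> differentiable F x.
Hypothesis Fid : forall x : 'rV[R]_n, `|x - x0| < r ->
  forall v, `|v - 'd F x v| <= 2^-1 * `|v|.

(** Triangle inequality on [v = (v - dF v) + dF v]; this is the lower bound required by
    [diff_inverse]. *)
Lemma near_id_diff_injective x (v : 'rV[R]_n) :
  `|x - x0| < r -> `|v| <= 2 * `|'d F x v|.
Proof.
move=> /Fid /(_ v) h; have := ler_normD (v - 'd F x v) ('d F x v).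
by rewrite subrK; lra.
Qed.

Lemma near_id_contraction (x y : 'rV[R]_n) : `|x - x0| < r -> `|y - x0| < r ->
  `|(x - F x) - (y - F y)| <= 2^-1 * `|x - y|.
Proof.
have di (z : 'rV[R]_n) : differentiable (idfun : 'rV[R]_n -> 'rV[R]_n) z.
  by apply: (@linear_differentiable _ _ _ idfun) => ?.
have did (z : 'rV[R]_n) : 'd idfun z = idfun :> ('rV[R]_n -> 'rV[R]_n).
  by apply: diff_lin => ?.
apply: (@mean_value_ineq n n (idfun - F) x0 r 2^-1).
- by rewrite invr_ge0.
- by move=> z zr; exact: (differentiableB (di z) (dF zr)).
move=> z zr v; have e := diffB (di z) (dF zr).
have -> : 'd (idfun - F) z v = v - 'd F z v.
  apply: etrans (congr1 (@^~ v) e) _.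
  exact: (congr1 (fun w => w - 'd F z v) (congr1 (@^~ v) (did z))).
exact: (Fid zr v).
Qed.

(** Yields both injectivity of [F] on the ball and the Lipschitz constant 2 of its inverse. *)
Lemma near_id_expansion (x y : 'rV[R]_n) : `|x - x0| < r -> `|y - x0| < r ->
  `|x - y| <= 2 * `|F x - F y|.
Proof.
move=> xr yr; have h := near_id_contraction xr yr.
have := ler_normD ((x - F x) - (y - F y)) (F x - F y).
have -> : (x - F x) - (y - F y) + (F x - F y) = x - y.
  by apply/rowP => j; rewrite !mxE; ring.
lra.
Qed.

(** A solution of [F x = y] is a fixed point of [x |-> x - F x + y]. This map is a contraction of
    the closed ball of radius [r/2]: it moves points at most [(r/2)/2 + r/4 = r/2] away from
    [x0]. *)
Lemma near_id_surjective (y : 'rV[R]_n) : `|y - F x0| < r / 4 ->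
  exists2 x, `|x - x0| < r & F x = y.
Proof.
move=> yr; pose C : set 'rV[R]_n := closed_ball_ Num.norm x0 (r / 2).
have [r2 r20] : r / 2 < r /\ 0 <= r / 2 by move: r0; split; lra.
have Cr x : C x -> `|x - x0| < r.
  by rewrite /C /closed_ball_ /= distrC => /le_lt_trans; apply.
have Cx0 : C x0 by rewrite /C /closed_ball_ /= subrr normr0.
pose f (x : 'rV[R]_n) := (x - F x) + y.
have fC : set_fun C C f.
  move=> x Cx; rewrite /C /closed_ball_ /= distrC.
  have xr : `|x - x0| <= r / 2 by rewrite distrC.
  have h1 := near_id_contraction (Cr _ Cx) (Cr _ Cx0).
  have h2 : `|f x - x0| <= `|(x - F x) - (x0 - F x0)| + `|y - F x0|.
    have -> : f x - x0 = (x - F x) - (x0 - F x0) + (y - F x0).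
      by apply/rowP => j; rewrite !mxE; ring.
    exact: ler_normD.
  lra.
pose f' : {fun C >-> C} := mkfun_fun fC.
have [|||x Cx fx] := @banach_fixed_point R (rV_completeNormedModType n) C f'.
- exists (2^-1)%:nng; split; first by rewrite /= invf_lt1 // ltr1n.
  move=> [a b] [/= Ca Cb].
  have e : (a - F a) - (b - F b) = f a - f b.
    by apply/rowP => j; rewrite !mxE; ring.
  by have := near_id_contraction (Cr _ Ca) (Cr _ Cb); rewrite e.
- exact: closed_closed_ball_.
- by exists x0.
exists x; first exact: Cr.
have {}fx : x = x - F x + y := fx.
by apply: (addrI (x - F x)); rewrite -[RHS]fx subrK.
Qed.

End near_identity.

(** * Smoothness of reciprocals, determinants and inverse matrices *)

Lemma Ck_big_sum n (W : normedModType R) k (U : set 'rV[R]_n) (I : Type)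
    (s : seq I) (f : I -> 'rV[R]_n -> W) :
  open U -> (forall i, Ck k U (f i)) -> Ck k U (fun x => \sum_(i <- s) f i x).
Proof.
move=> oU fk; elim: s => [|i s IH].
  by under eq_fun do rewrite big_nil; exact: Ck_cst.
by under eq_fun do rewrite big_cons; exact: Ck_add.
Qed.

Lemma Ck_big_prod n k (U : set 'rV[R]_n) (I : Type)
    (s : seq I) (f : I -> 'rV[R]_n -> R) :
  open U -> (forall i, Ck k U (f i)) -> Ck k U (fun x => \prod_(i <- s) f i x).
Proof.
move=> oU fk; elim: s => [|i s IH].
  by under eq_fun do rewrite big_nil; exact: Ck_cst.
by under eq_fun do rewrite big_cons; exact: Ck_mul.
Qed.

(** Induction on [k]: the derivative of [1/f] is [- f^-2 Df], in which [1/f] occurs one order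
    lower. *)
Lemma Ck_inv n k (U : set 'rV[R]_n) (f : 'rV[R]_n -> R) :
  open U -> (forall x, U x -> f x != 0) -> Ck k U f ->
  Ck k U (fun x => (f x)^-1).
Proof.
move=> oU f0; elim: k => [|k IH] fk.
  by move=> x Ux; apply: continuousV; [exact: f0|exact: fk].
have [df Df] := fk; have fVk := IH (Ck_pred fk).
split=> [x Ux|v]; first by apply: differentiableV; [exact: df|exact: f0].
have := Ck_mul oU (Ck_mul oU (Ck_cst k U (-1 : R)) (Ck_mul oU fVk fVk)) (Df v).
apply: Ck_ext => // x Ux.
rewrite [RHS]deriveV; [|exact: f0|exact/diff_derivable/df].
by rewrite !fctE mulN1r -expr2 exprVn.
Qed.

Lemma Ck_det n m k (U : set 'rV[R]_n) (A : 'rV[R]_n -> 'M[R]_m) :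
  open U -> (forall i j, Ck k U (fun x => A x i j)) ->
  Ck k U (fun x => \det (A x)).
Proof.
move=> oU Ak; apply: Ck_big_sum => // s; apply: Ck_mul => //.
  exact: (@Ck_cst R n R k U).
exact: Ck_big_prod.
Qed.

(** Cramer's formula: the entries are cofactors divided by the determinant. *)
Lemma Ck_invmx n m k (U : set 'rV[R]_n) (A : 'rV[R]_n -> 'M[R]_m) :
  open U -> (forall i j, Ck k U (fun x => A x i j)) ->
  (forall x, U x -> A x \in unitmx) ->
  forall i j, Ck k U (fun x => invmx (A x) i j).
Proof.
move=> oU Ak uA i j.
have cA : Ck k U (fun x => cofactor (A x) j i).
  apply: Ck_mul => //; first exact: (Ck_cst k U ((-1) ^+ (j + i) : R)).
  by apply: Ck_det => // a b; under eq_fun do rewrite !mxE; exact: Ak.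
have := Ck_mul oU (Ck_inv oU _ (Ck_det oU Ak)) cA.
have /[swap]/[apply] : forall x, U x -> \det (A x) != 0.
  by move=> x /uA; rewrite unitmxE unitfE.
by apply: Ck_ext => // x Ux; rewrite /invmx uA // !mxE.
Qed.

(** The estimates of the previous section give an inverse that is 2-Lipschitz, hence differentiable
    by [diff_inverse]. Smoothness follows by bootstrapping from [dG = (JF o G)^-1]. The derivative
    is normalized to the identity here; the applications reach this case by composing with a linear
    or affine map. *)
Theorem inverse_function n (U : set 'rV[R]_n) (F : 'rV[R]_n -> 'rV[R]_n)
    (x0 : 'rV[R]_n) :
  open U -> U x0 -> Cinfty U F -> (forall v, 'd F x0 v = v) ->
  exists V G, [/\ open V, V (F x0), Cinfty V G,
    forall y, V y -> U (G y) /\ F (G y) = y &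
    \forall x \near x0, V (F x) /\ G (F x) = x].
Proof.
move=> oU Ux0 FC Fid.
have [r r0 hr] := derive_near_id oU Ux0 (FC 1%N) Fid.
have UB (x : 'rV[R]_n) : `|x - x0| < r -> U x by move=> /hr[].
have [dF _] := FC 1%N.
have dFB (x : 'rV[R]_n) : `|x - x0| < r -> differentiable F x by move=> /UB/dF.
have hB (x : 'rV[R]_n) : `|x - x0| < r ->
    forall v, `|v - 'd F x v| <= 2^-1 * `|v| by move=> /hr[].
pose V : set 'rV[R]_n := [set y | `|y - F x0| < r / 4].
have oV : open V.
  have -> : V = ball (F x0) (r / 4).
    by apply/seteqP; rewrite -ball_normE; split=> y; rewrite /V /= distrC.
  exact: ball_open.
(* The default [x0] is returned only outside the image of the ball, hence never on [V]. *)
pose G (y : 'rV[R]_n) := xget x0 [set x | `|x - x0| < r /\ F x = y].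
have GP (y : 'rV[R]_n) : V y -> `|G y - x0| < r /\ F (G y) = y.
  move=> Vy; have [x xr xy] := near_id_surjective r0 dFB hB Vy.
  apply: (@xgetPex _ x0 [set x | `|x - x0| < r /\ F x = y]).
  by exists x.
have GL (y z : 'rV[R]_n) : V y -> V z -> `|G z - G y| <= 2 * `|z - y|.
  move=> /GP[yr Fy] /GP[zr Fz].
  by have := near_id_expansion dFB hB zr yr; rewrite Fz Fy.
have nV (y : 'rV[R]_n) : V y -> \forall z \near y, V z.
  by move=> Vy; exact: (open_nbhs_nbhs (conj oV Vy)).
have Gc (y : 'rV[R]_n) : V y -> {for y, continuous G}.
  move=> Vy; apply/(@cvgrPdist_le _ _ _ (nbhs y)) => e e0; near=> z.
  have Vz : V z by near: z; exact: nV.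
  rewrite distrC; apply: le_trans (GL _ _ Vy Vz) _.
  have : `|y - z| <= e / 2 by near: z; apply: cvgr_dist_le => //; lra.
  by rewrite distrC; lra.
have Gd (y : 'rV[R]_n) (Vy : V y) :
    'J F (G y) \in unitmx /\ differentiable G y /\
    forall v, 'd G y v = v *m invmx ('J F (G y)).
  have [yr _] := GP y Vy.
  apply: diff_inverse; [exact: dFB| |exact: Gc|].
    by move=> v; exact: (near_id_diff_injective hB).
  apply: filterS (nV y Vy) => z Vz; split; first by have [] := GP z Vz.
  exact: GL.
have GU y : V y -> U (G y) by move=> /GP[/UB].
have GC : Cinfty V G.
  elim=> [|k IH]; first exact: Gc.
  split=> [y /Gd[_ []] //|v].
  (* If [G] is [C^k], so is the Jacobian of [F] along [G], then its inverse, which is the derivative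
     of [G]; so [G] is [C^(k+1)]. *)
  have Jk i j : Ck k V (fun y => 'J F (G y) i j).
    have Dk := Ck_comp oV oU GU IH ((FC k.+1).2 (delta_mx 0 i)).
    apply: (Ck_ext oV _ ((Ck_coord _ _ oV).1 Dk j)) => y /GU Uy /=.
    by rewrite deriveEjacobian ?rowE -?rowE ?mxE //; exact: dF.
  have uJ y : V y -> 'J F (G y) \in unitmx by move=> /Gd[].
  have Ik := Ck_invmx oV Jk uJ.
  apply/(Ck_coord _ _ oV) => j.
  have : Ck k V (fun y => \sum_i v 0 i * invmx ('J F (G y)) i j).
    apply: Ck_big_sum => // i; apply: Ck_mul => //.
    exact: (Ck_cst k V (v 0 i)).
  apply: Ck_ext => // y /Gd[_ [dG dGE]].
  by rewrite deriveE // dGE mxE.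
exists V, G; split => //.
- by rewrite /V /= subrr normr0; lra.
- by move=> y Vy; split; [exact: GU|have [] := GP y Vy].
have FV : \forall x \near x0, V (F x).
  apply: (differentiable_continuous (dF _ Ux0)); apply: nV.
  by rewrite /V /= subrr normr0; lra.
near=> x.
have Vx : V (F x) by near: x.
split => //; have [Gr FG] := GP _ Vx.
have xr : `|x - x0| < r.
  by rewrite distrC; near: x; apply: cvgr_dist_lt.
(* [G (F x)] and [x] are two points of the ball with the same image, so they coincide. *)
have := near_id_expansion dFB hB Gr xr.
rewrite FG subrr normr0 mulr0 => h; apply/eqP.
by rewrite -subr_eq0 -normr_eq0; apply/eqP/le_anti; rewrite h normr_ge0.
Unshelve. all: by end_near. Qed.

End calculus.

(** * Submersions, immersions and embeddings *)

Section manifolds.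
Local Open Scope classical_set_scope.
Local Open Scope ring_scope.
Context {R : realType}.
Implicit Types M N P : manifoldType R.

Lemma smooth_in_sub M N (V W : set M) (f : M -> N) :
  V `<=` W -> smooth_in W f -> smooth_in V f.
Proof.
move=> VW [fc fk]; split=> [x /VW/fc //|c d ac ad k].
apply: (Ck_sub _ (fk c d ac ad k)) => _ [y [[/VW Wy cy] dy] <-].
by exists y.
Qed.

(** Needed for maps known only to agree near each point with some smooth map, such as lifts through
    an embedding. *)
Lemma smooth_in_glue M N (W : set M) (f : M -> N) : open W ->
  (forall x, W x -> exists V g, [/\ open V, V x, smooth_in V g &
    forall y, V y -> W y -> g y = f y]) ->
  smooth_in W f.
Proof.
move=> oW h.
have fc x : W x -> {for x, continuous f}.
  move=> Wx; have [V [g [oV Vx [gc _] gf]]] := h x Wx.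
  rewrite /prop_for /continuous_at -(gf _ Vx Wx).
  apply: (@cvg_trans _ (g @ x)); last exact: gc.
  apply: (@near_eq_cvg _ _ (nbhs x)).
  have nVW : nbhs x (V `&` W) by apply: open_nbhs_nbhs; split => //; exact: openI.
  by apply: filterS nVW => y [Vy Wy]; exact: gf.
apply: smooth_in_local => // x Wx.
have [V [g [oV Vx [gc gk] gf]]] := h x Wx.
have [c ac cx] := atlas_cover x; have [d ad dx] := atlas_cover (f x).
exists c, d; split => //.
exists (c @` (V `&` W `&` chart_dom c `&` g @^-1` chart_dom d)).
have oT : open (c @` (V `&` W `&` chart_dom c `&` g @^-1` chart_dom d)).
  apply: chart_rep_dom_open; [exact: openI|by move=> y [/gc]|].
  exact: chart_dom_open.
split=> //; first by exists x => //; do !split => //=; rewrite gf.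
move=> k; apply: (@Ck_ext _ _ _ _ _ (d \o g \o chart_inv c)) => //.
  by move=> _ [y [[[Vy Wy] cy] dy] <-] /=; rewrite chart_mapK // gf.
by apply: (Ck_sub _ (gk c d ac ad k)) => _ [y [[[Vy Wy] cy] dy] <-]; exists y.
Qed.

(** Brings the coordinate maps produced by [inverse_function] back to the manifolds. *)
Lemma smooth_in_chart M N (c : chart R (mfd_dim M) M) (d : chart R (mfd_dim N) N)
    (h : 'rV[R]_(mfd_dim M) -> 'rV[R]_(mfd_dim N)) (V : set 'rV[R]_(mfd_dim M)) :
  atlas c -> atlas d -> open V -> Cinfty V h ->
  (forall v, V v -> (d @` chart_dom d) (h v)) ->
  open (chart_dom c `&` c @^-1` V) /\
  smooth_in (chart_dom c `&` c @^-1` V) (chart_inv d \o h \o c).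
Proof.
move=> ac ad oV hV hd; set W := _ `&` _.
have oW : open W.
  apply: open_preimage_in => //; first exact: chart_dom_open.
  exact: chart_map_continuous.
have dhd v : V v ->
    chart_dom d (chart_inv d (h v)) /\ d (chart_inv d (h v)) = h v.
  by move=> /hd[y dy <-]; rewrite chart_mapK.
split=> //; apply: smooth_in_local => // x [cx Vx].
  apply: continuous_comp; first exact: chart_map_continuous.
  apply: continuous_comp; first exact: (Ck_continuous (hV 0%N)).
  exact/chart_inv_continuous/hd.
exists c, d; split => //; first by have [] := dhd _ Vx.
exists (c @` W); split.
- by apply: chart_image_open => // y [].
- by exists x.
move=> k; apply: (@Ck_ext _ _ _ _ _ h).
- by apply: chart_image_open => // y [].
- move=> _ [y [cy Vy] <-] /=; rewrite chart_mapK //.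
  by have [_ ->] := dhd _ Vy.
by apply: (Ck_sub _ (hV k)) => _ [y [cy Vy] <-].
Qed.

Lemma Ck_mulmxr n m k (U : set 'rV[R]_n) (B : 'M[R]_(n, m)) :
  Ck k U (fun v => v *m B).
Proof.
apply: (@Ck_linear _ _ _ k U (mulmxr B)); exact: linear_rV_continuous.
Qed.

Lemma diff_mulmxr n m (B : 'M[R]_(n, m)) (x : 'rV[R]_n) :
  differentiable (fun v : 'rV[R]_n => v *m B) x /\
  forall w, 'd (fun v : 'rV[R]_n => v *m B) x w = w *m B.
Proof.
have Bc : continuous (mulmxr B : 'rV[R]_n -> 'rV[R]_m).
  exact: linear_rV_continuous.
split; first exact: (@linear_differentiable _ _ _ (mulmxr B)).
by move=> w; rewrite (@diff_lin _ _ _ (mulmxr B)).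
Qed.

Lemma chart_rep_smooth M N (f : M -> N) c d : smooth f -> atlas c -> atlas d ->
  open (c @` (chart_dom c `&` f @^-1` chart_dom d)) /\
  Cinfty (c @` (chart_dom c `&` f @^-1` chart_dom d)) (d \o f \o chart_inv c).
Proof.
move=> [fc fk] ac ad; rewrite -(setTI (chart_dom c)).
split=> [|k]; last exact: fk.
apply: chart_rep_dom_open => //; [exact: openT|exact: chart_dom_open].
Qed.

(** Surjectivity of the derivative gives [B] with [B J = 1]. In charts, [f] after an affine map [A]
    with linear part [B] then has derivative the identity; if [G] is its local inverse, [A o G] is
    the section. *)
Lemma submersion_has_section M N (f : M -> N) (x : M) : submersion f ->
  exists V s, [/\ open V, V (f x), smooth_in V s, s (f x) = x &
    forall y, V y -> f (s y) = y].
Proof.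
move=> [fs fsub].
have [c ac cx] := atlas_cover x; have [d ad dx] := atlas_cover (f x).
have [oO fO] := chart_rep_smooth fs ac ad.
set O := c @` _ in oO fO; set fh := d \o f \o chart_inv c in fO.
have Ox : O (c x) by exists x.
have fhx : fh (c x) = d (f x) by rewrite /fh /= chart_mapK.
have dfh : differentiable fh (c x) by have [+ _] := fO 1%N; exact.
set J := 'J fh (c x).
have JE v : 'd fh (c x) v = v *m J by rewrite mul_rV_lin1.
have [B BJ] : exists B, B *m J = 1%:M.
  apply/row_fullP; rewrite -sub1mx; apply/row_subP => i.
  have [v vi] := fsub x c d ac ad cx dx (row i 1%:M).
  by rewrite -vi JE submxMl.
(* The constant term makes [A] send [d (f x)] to [c x], so that the section passes through [x]. *)
pose A (v : 'rV[R]_(mfd_dim N)) := v *m B + (c x - d (f x) *m B).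
have Ax : A (d (f x)) = c x by rewrite /A addrC subrK.
have AC k : Ck k setT A.
  by apply: Ck_add; [exact: openT|exact: Ck_mulmxr|exact: Ck_cst].
have oU : open (setT `&` A @^-1` O).
  by apply: open_preimage_in => //; [exact: openT|exact: (AC 0%N)].
rewrite setTI in oU.
have FC : Cinfty (A @^-1` O) (fh \o A).
  move=> k; apply: (Ck_comp oU oO _ (Ck_sub _ (AC k)) (fO k)) => //.
have [dB dBE] := diff_mulmxr B (d (f x)).
have dA : differentiable A (d (f x)).
  by apply: differentiableD => //; exact: differentiable_cst.
have dAE w : 'd A (d (f x)) w = w *m B.
  have e := diffD dB (differentiable_cst (c x - d (f x) *m B) (d (f x))).
  apply: etrans (congr1 (@^~ w) e) _.
  have e0 := diff_cst (V := 'rV[R]_(mfd_dim N)) (c x - d (f x) *m B) (d (f x)).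
  have e0w : 'd (cst (c x - d (f x) *m B)) (d (f x)) w = 0 := congr1 (@^~ w) e0.
  apply: etrans (congr1 (+%R ('d (fun v => v *m B) (d (f x)) w)) e0w) _.
  by rewrite addr0.
have dF v : 'd (fh \o A) (d (f x)) v = v.
  rewrite -Ax in dfh.
  have e := diff_comp dA dfh.
  apply: etrans (congr1 (@^~ v) e) _.
  by rewrite /= dAE Ax JE -mulmxA BJ mulmx1.
have [|V [G [oV VF GC FG GF]]] := inverse_function oU _ FC dF.
  by rewrite /= Ax.
have Fx : (fh \o A) (d (f x)) = d (f x) by rewrite /= Ax fhx.
rewrite Fx in VF.
have Gx : G (d (f x)) = d (f x).
  by have [_] := nbhs_singleton GF; rewrite Fx.
have AGC : Cinfty V (A \o G).
  by move=> k; apply: (Ck_comp oV openT _ (GC k) (AC k)).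
have hc v : V v -> (c @` chart_dom c) ((A \o G) v).
  by move=> /FG[/= [y [cy _] yE] _]; exists y.
have [oW sW] := smooth_in_chart ad ac oV AGC hc.
exists (chart_dom d `&` d @^-1` V), (chart_inv c \o (A \o G) \o d); split => //.
  by rewrite /= Gx Ax chart_mapK.
move=> y [dy /FG[/= [z [cz dfz] zE]]].
rewrite /fh /= -zE chart_mapK // => e.
by rewrite -(chart_mapK dfz) e chart_mapK.
Qed.

(** Dual to the previous lemma: injectivity of the derivative gives [B] with [J B = 1], and [f] in
    charts followed by [B] has derivative the identity. *)
Lemma immersion_has_left_inverse M N (f : M -> N) (x : M) : immersion f ->
  exists V r, [/\ open V, V (f x), smooth_in V r &
    \forall y \near x, r (f y) = y].
Proof.
move=> [fs fimm].
have [c ac cx] := atlas_cover x; have [d ad dx] := atlas_cover (f x).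
have [oO fO] := chart_rep_smooth fs ac ad.
set O := c @` _ in oO fO; set fh := d \o f \o chart_inv c in fO.
have Ox : O (c x) by exists x.
have fhx : fh (c x) = d (f x) by rewrite /fh /= chart_mapK.
have dfh : differentiable fh (c x) by have [+ _] := fO 1%N; exact.
set J := 'J fh (c x).
have JE v : 'd fh (c x) v = v *m J by rewrite mul_rV_lin1.
have [B JB] : exists B, J *m B = 1%:M.
  apply/row_freeP; rewrite -kermx_eq0; apply/rowV0P => v /sub_kermxP vJ.
  by apply: (fimm x c d ac ad cx dx); rewrite linear0 [LHS]JE.
have FC : Cinfty O ((fun v => v *m B) \o fh).
  by move=> k; apply: (Ck_comp oO openT _ (fO k) (Ck_mulmxr k setT B)).
have dF v : 'd ((fun v => v *m B) \o fh) (c x) v = v.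
  have [dB dBE] := diff_mulmxr B (fh (c x)).
  apply: etrans (congr1 (@^~ v) (diff_comp dfh dB)) _.
  by rewrite /= dBE JE -mulmxA JB mulmx1.
have [V [G [oV VF GC FG GF]]] := inverse_function oO Ox FC dF.
have oV' : open ((fun v => v *m B) @^-1` V).
  rewrite -[X in open X]setTI.
  exact: (open_preimage_in openT (Ck_mulmxr 0 setT B) oV).
have rC : Cinfty ((fun v => v *m B) @^-1` V) (G \o (fun v => v *m B)).
  by move=> k; apply: (Ck_comp oV' oV _ (Ck_mulmxr k _ B) (GC k)).
have hc v : ((fun v => v *m B) @^-1` V) v ->
    (c @` chart_dom c) ((G \o (fun v => v *m B)) v).
  by move=> /FG[/= [y [cy _] yE] _]; exists y.
have [oW sW] := smooth_in_chart ad ac oV' rC hc.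
exists (chart_dom d `&` d @^-1` ((fun v => v *m B) @^-1` V)),
  (chart_inv c \o (G \o (fun v => v *m B)) \o d); split => //.
  by split => //=; move: VF; rewrite /= fhx.
have ncx : \forall y \near x, chart_dom c y.
  by apply: open_nbhs_nbhs; split => //; exact: chart_dom_open.
have := chart_map_continuous cx GF.
rewrite /= => nG; near=> y.
have cy : chart_dom c y by near: y.
have [_] : V (fh (c y) *m B) /\ G (fh (c y) *m B) = c y by near: y.
by rewrite /fh /= chart_mapK // => ->; rewrite chart_mapK.
Unshelve. all: by end_near. Qed.

(** Locally [g = r o h] with [r] a left inverse of [f]. Since [r] inverts [f] only near [g x] and
    [g] is not known to be continuous, relative openness of [f] is what keeps [g y] near [g x] when
    [h y] is near [h x]. *)
Lemma embedding_lift_smooth M N P (f : M -> N) (W : set P) (h : P -> N)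
    (g : P -> M) :
  embedding f -> open W -> smooth_in W h -> (forall x, W x -> f (g x) = h x) ->
  smooth_in W g.
Proof.
move=> [fi finj fo] oW hs fg; apply: smooth_in_glue => // x Wx.
have [V [r [oV Vx rs rf]]] := immersion_has_left_inverse (g x) fi.
have [U' [oU' U'x rf']] : exists U,
    [/\ open U, U (g x) & forall y, U y -> r (f y) = y].
  have := rf; rewrite /prop_near1 nbhsE => -[U [oU Ux] UP].
  by exists U; split.
have [V' oV' V'E] := fo U' oU'.
have V'x : V' (f (g x)).
  by have [] : (range f `&` V') (f (g x)) by rewrite -V'E; exists (g x).
exists (W `&` h @^-1` (V `&` V')), (r \o h).
have oW' : open (W `&` h @^-1` (V `&` V')).
  by apply: open_preimage_in => //; [exact: hs.1|exact: openI].
split => //.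
- by rewrite /= -fg.
- apply: (@smooth_in_comp _ _ _ _ _ V) => //; first by move=> y [_ []].
  by apply: smooth_in_sub hs => ? [].
move=> y [_ [Vy V'y]] Wy /=; rewrite -fg //.
(* Injectivity of [f] then identifies [u] with [g y]. *)
have [u U'u uE] : (f @` U') (f (g y)).
  by rewrite V'E; split; [exists (g y)|rewrite fg].
by rewrite -uE rf' // -(finj _ _ uE).
Qed.

(** The left inverse must hold for every point whose image lies in [V], not only for points near
    [x]; this excludes distant points with nearby images and gives injectivity and relative
    openness. The chain rule gives the immersion. *)
Lemma embedding_local_left_inverse M N (f : M -> N) : smooth f ->
  (forall x, exists V r, [/\ open V, V (f x), smooth_in V r &
    forall y, V (f y) -> r (f y) = y]) -> embedding f.
Proof.
move=> fs h; have finj : injective f.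
  move=> x y e; have [V [r [_ Vx _ rf]]] := h x.
  by rewrite -[x]rf // e rf // -e.
split => //.
  split=> // x c d ac ad cx dx w w' e.
  have [V [r [oV Vx rs rf]]] := h x; have [rc rk] := rs.
  have [oO fO] := chart_rep_smooth fs ac ad.
  have Ox : (c @` (chart_dom c `&` f @^-1` chart_dom d)) (c x) by exists x.
  have dS : differentiable (d \o f \o chart_inv c) (c x).
    by have [+ _] := fO 1%N; exact.
  have dR : differentiable (c \o r \o chart_inv d) (d (f x)).
    have [+ _] := rk d c ad ac 1%N; apply; exists (f x) => //.
    by split => //=; rewrite rf.
  have Sx : (d \o f \o chart_inv c) (c x) = d (f x) by rewrite /= chart_mapK.
  have nU : \forall v \near c x,
      v = (c \o r \o chart_inv d) ((d \o f \o chart_inv c) v).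
    have oU : open (c @` (setT `&` chart_dom c `&` f @^-1` (V `&` chart_dom d))).
      apply: chart_rep_dom_open; [exact: openT|exact: fs.1|].
      by apply: openI => //; exact: chart_dom_open.
    have Ux : (c @` (setT `&` chart_dom c `&` f @^-1` (V `&` chart_dom d))) (c x).
      by exists x.
    apply: filterS (open_nbhs_nbhs (conj oU Ux)) => _ [y [[_ cy] [Vy dy]] <-] /=.
    by rewrite (chart_mapK cy) (chart_mapK dy) rf.
  have k := diff_right_inverse dS dR Sx nU.
  by rewrite -(k w) -(k w') e.
move=> U oU.
(* The largest candidate is taken: the union of all open sets whose preimage lies in [U]. Near [f x]
   the set [V] cut by [r^-1(U)] is one of them. *)
pose good := [set A : set N | open A /\ f @^-1` A `<=` U].
exists (\bigcup_(A in good) A).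
  by apply: bigcup_open => A [].
apply/seteqP; split=> [_ [x Ux <-]|_ [[x _ <-] [A [_ AU] Ax]]]; last first.
  by exists x => //; exact: AU.
split; first by exists x.
have [V [r [oV Vx [rc _] rf]]] := h x.
exists (V `&` r @^-1` U); last by split => //=; rewrite rf.
split; first exact: open_preimage_in.
by move=> y [Vy /=]; rewrite rf.
Qed.

Lemma smooth_in_pair M N P (W : set P) (f : P -> M) (g : P -> N) : open W ->
  smooth_in W f -> smooth_in W g -> smooth_in W (fun x => (f x, g x)).
Proof.
move=> oW [fc fk] [gc gk]; apply: smooth_in_local => // x Wx.
  by apply: pair_continuous; [exact: fc|exact: gc].
have [c ac cx] := atlas_cover x; have [d ad dx] := atlas_cover (f x).
have [e ae ex] := atlas_cover (g x).
exists c, (prod_chart d e); split => //; first by exists d => //; exists e.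
pose O1 := c @` (W `&` chart_dom c `&` f @^-1` chart_dom d).
pose O2 := c @` (W `&` chart_dom c `&` g @^-1` chart_dom e).
have oO1 : open O1 by apply: chart_rep_dom_open => //; exact: chart_dom_open.
have oO2 : open O2 by apply: chart_rep_dom_open => //; exact: chart_dom_open.
exists (O1 `&` O2); split; [exact: openI|by split; exists x|].
move=> k; apply: Ck_row_mx; first exact: openI.
  by apply: (Ck_sub _ (fk c d ac ad k)) => ? [].
by apply: (Ck_sub _ (gk c e ac ae k)) => ? [].
Qed.

Lemma smooth_smooth_in M N (W : set M) (f : M -> N) : smooth f -> smooth_in W f.
Proof. exact: smooth_in_sub. Qed.

Lemma smooth_compr_in M N P (W : set M) (f : M -> N) (g : N -> P) :
  open W -> smooth_in W f -> smooth g -> smooth_in W (g \o f).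
Proof. by move=> oW fs gs; apply: (smooth_in_comp oW openT _ fs gs). Qed.

Lemma smooth_on_comp M N P (W : set P) (A : set M) (h : P -> M) (f : M -> N) :
  open W -> smooth_in W h -> (forall x, W x -> A (h x)) -> smooth_on A f ->
  smooth_in W (f \o h).
Proof.
move=> oW hs WA fA; apply: smooth_in_glue => // x Wx.
have [V [g [oV Vx gs] gf]] := fA _ (WA x Wx).
have oWV : open (W `&` h @^-1` V) by apply: open_preimage_in => //; exact: hs.1.
exists (W `&` h @^-1` V), (g \o h); split => //.
  apply: (smooth_in_comp oWV oV _ _ gs) => [y []//|].
  by apply: smooth_in_sub hs => y [].
by move=> y [_ Vy] Wy /=; apply: gf => //; exact: WA.
Qed.

Lemma preimage_smooth_open M N (f : M -> N) (U : set N) :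
  smooth f -> open U -> open (f @^-1` U).
Proof.
move=> [fc _] oU; rewrite -[X in open X]setTI.
by apply: open_preimage_in => //; exact: openT.
Qed.

End manifolds.

(** * Twisted bundles and extensions *)

Section principal_bundles.
Local Open Scope classical_set_scope.
Context {R : realType} {P B : manifoldType R} {G : lieGroupType R}.
Variables (pi : P -> B) (act : P * G -> P).
Hypothesis PB : principal_bundle pi act.

(** In a trivialization the two points differ only in their [G] components, and [g] is the quotient
    of these. *)
Lemma principal_bundle_transitive p q : pi p = pi q ->
  exists g, q = act (p, g).
Proof.
move=> pq.
have [U [triv [triv' [oU Up [_ _ tK _ tM]]]]] := principal_trivial PB (pi p).
have Uq : U (pi q) by rewrite -pq.
exists ((triv p).2^-1 * (triv q).2)%g.
have [p1 _] := tK _ Up; have [q1 qK] := tK _ Uq.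
have Ua : U (pi (act (p, ((triv p).2^-1 * (triv q).2)%g))).
  by rewrite principal_fiber.
have [_ <-] := tK _ Ua; rewrite tM // mulVKg p1 pq -q1 -[in LHS]qK.
by case: (triv q).
Qed.

(** Through each [p] passes a local section with constant [G] component in a trivialization. *)
Lemma principal_bundle_surjective_submersion : surjective_submersion pi.
Proof.
split.
  apply: submersion_local_section; first exact: principal_proj_smooth PB.
  move=> p.
  have [U [triv [triv' [oU Up [_ st' tK t'K _]]]]] := principal_trivial PB (pi p).
  exists U, (fun b => triv' (b, (triv p).2)); split => //.
  - have oUT : open (U `*` [set: G]) by apply: open_setX => //; exact: openT.
    apply: (smooth_in_comp (f := fun b => (b, (triv p).2)) oU oUT _ _ st') => //.
    apply: smooth_in_pair => //; apply: smooth_smooth_in; first exact: smooth_id.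
    exact: smooth_cst.
  - have [p1 pK] := tK _ Up; rewrite -[RHS]pK -p1; by case: (triv p).
  - by move=> b Ub; have [] := t'K (b, (triv p).2) Ub.
move=> b; have [U [triv [triv' [_ Ub [_ _ _ t'K _]]]]] := principal_trivial PB b.
by exists (triv' (b, 1%g)); have [] := t'K (b, 1%g) Ub.
Qed.

End principal_bundles.

(** * From twisted bundles to extensions *)

Section bundle_to_extension.
Local Open Scope classical_set_scope.
Context {R : realType} {G : lieGroupType R} {X0 : manifoldType R}.
Variables (E X : lieGroupoid X0) (pi : E -> X) (eta act : E * G -> E).
Hypothesis TB : twisted_principal_bundle idfun pi eta act.

Let PB := twisted_principal TB.
Let actS := action_smooth (principal_action PB).
Let i (p : group_bundle X0 G) : E := act (gunit E p.1, p.2).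

Let i_smooth : smooth i.
Proof.
apply: (smooth_comp (f := fun p : X0 * G => (gunit E p.1, p.2)) _ actS).
apply: smooth_pair; last exact: smooth_snd.
exact: (smooth_comp (@smooth_fst R _ _) (gunit_smooth E)).
Qed.

Let i_src p : gsrc (i p) = p.1.
Proof. by rewrite (twisted_action_src (twisted_twisted_action TB)) gsrc_unit. Qed.

Let i_tgt p : gtgt (i p) = p.1.
Proof. by rewrite (twisted_action_tgt (twisted_twisted_action TB)) gtgt_unit. Qed.

Let pi_i p : pi (i p) = gunit X p.1.
Proof. by rewrite (principal_fiber PB) (morphism_unit (twisted_morphism TB)). Qed.

Let i_morphism : lie_groupoid_morphism idfun i.
Proof.
split=> //.
- exact: smooth_id.
- by move=> x; rewrite /i (twisted_action_unit (twisted_twisted_action TB)).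
move=> [y g2] [x g1] /= xy; rewrite /i /= -xy.
rewrite (twisted_action_comp (twisted_twisted_action TB)); last first.
  by rewrite gsrc_unit gtgt_unit.
(* [eta] fixes units, so the twisted composition law restricts to the plain product of [G]. *)
rewrite (twisting_unit (twisted_twisting TB)).
have -> : gcomp (gunit E x) (gunit E x) = gunit E x.
  by rewrite -{2}(gsrc_unit E x) gcompf1.
by [].
Qed.

Let i_embedding : embedding i.
Proof.
apply: embedding_local_left_inverse => // -[x g].
have [U [triv [triv' [oU Ux [st _ tK _ tM]]]]] :=
  principal_trivial PB (gunit X x).
have ssrc : smooth (@gsrc _ _ E) := (gsrc_submersion E).1.1.
have su : smooth (fun f : E => gunit E (gsrc f)).
  exact: smooth_comp ssrc (gunit_smooth E).
have spi := principal_proj_smooth PB.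
have oV : open (pi @^-1` U) := preimage_smooth_open spi oU.
have oV' : open ((fun f : E => gunit E (gsrc f)) @^-1` (pi @^-1` U)).
  exact: (preimage_smooth_open su oV).
have piu y : pi (gunit E y) = gunit X y.
  by rewrite (morphism_unit (twisted_morphism TB)).
(* The formula for the left inverse evaluates [triv] at [f] and at the unit of its source; both must
   lie over [U]. *)
exists (pi @^-1` U `&` (fun f : E => gunit E (gsrc f)) @^-1` (pi @^-1` U)).
exists (fun f : E => (gsrc f, ((triv (gunit E (gsrc f))).2^-1 * (triv f).2)%g)).
have oVV := openI oV oV'.
split=> //.
- by split; rewrite /= ?i_src ?piu ?pi_i.
- apply: smooth_in_pair => //; first exact: smooth_smooth_in.
  apply: (smooth_compr_in
    (f := fun f : E => ((triv (gunit E (gsrc f))).2^-1, (triv f).2)%g)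
    (g := fun p : G * G => (p.1 * p.2)%g) oVV _ (@mulg_smooth R G)).
  apply: smooth_in_pair => //.
    apply: (smooth_compr_in (f := fun f : E => (triv (gunit E (gsrc f))).2)
      oVV _ (@invg_smooth R G)).
    apply: (smooth_compr_in (f := fun f : E => triv (gunit E (gsrc f)))
      oVV _ (@smooth_snd R X G)).
    apply: (smooth_in_comp oVV oV _ _ st) => [f []//|].
    exact: smooth_smooth_in.
  apply: (smooth_compr_in oVV _ (@smooth_snd R X G)).
  by apply: smooth_in_sub st => f [].
move=> [y h] [Uy Uu].
rewrite i_src /=; congr (_, _); rewrite /i /= tM; last first.
  by move: Uu; rewrite /= i_src.
by rewrite /= mulKg.
Qed.

Lemma twisted_bundle_extension : @lie_groupoid_extension R X0 G E X i pi.
Proof.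
split.
- exact: i_morphism.
- exact: twisted_morphism TB.
- exact: i_embedding.
- exact: principal_bundle_surjective_submersion PB.
apply/seteqP; split=> [_ [p _ <-]|f [x fx]].
  by exists p.1; exact: pi_i.
have [|g ->] := @principal_bundle_transitive _ _ _ _ _ _ PB (gunit E x) f.
  by rewrite (morphism_unit (twisted_morphism TB)).
by exists (x, g).
Qed.

End bundle_to_extension.

Section groupoid_cancellation.
Context {R : realType} {M : manifoldType R} (X : lieGroupoid M).

Lemma gcompKV (f g : X) : gtgt g = gtgt f -> gcomp f (gcomp (ginv f) g) = g.
Proof.
move=> gf; rewrite gcompA ?gsrc_inv ?gtgt_inv // gcompgV -gf.
exact: gcomp1f.
Qed.

Lemma gcompVK (f g : X) : gtgt g = gsrc f -> gcomp (ginv f) (gcomp f g) = g.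
Proof.
move=> gf; rewrite gcompA ?gsrc_inv // gcompVg -gf.
exact: gcomp1f.
Qed.

End groupoid_cancellation.

(** * From extensions to twisted bundles *)

Section extension_to_bundle.
Local Open Scope classical_set_scope.
Context {R : realType} {G : lieGroupType R} {M : manifoldType R}.
Variables (Gamma2 Gamma1 : lieGroupoid M).
Variables (i : group_bundle M G -> Gamma2) (phi : Gamma2 -> Gamma1).
Hypothesis EX : lie_groupoid_extension i phi.

Let iM := extension_inj_morphism EX.
Let phiM := extension_proj_morphism EX.
Let eta (p : Gamma2 * G) : Gamma2 :=
  gcomp (i (gtgt p.1, p.2)) (gcomp p.1 (i (gsrc p.1, p.2^-1%g))).
Let act (p : Gamma2 * G) : Gamma2 := gcomp p.1 (i (gsrc p.1, p.2)).

Let i_inj : injective i.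
Proof. by have [] := extension_embedding EX. Qed.

Let i_src p : gsrc (i p) = p.1. Proof. exact: (morphism_src iM). Qed.
Let i_tgt p : gtgt (i p) = p.1. Proof. exact: (morphism_tgt iM). Qed.
Let i_unit x : i (x, 1%g) = gunit Gamma2 x. Proof. exact: (morphism_unit iM). Qed.

Let i_comp x g h : gcomp (i (x, g)) (i (x, h)) = i (x, (g * h)%g).
Proof. by rewrite -(@morphism_comp _ _ _ _ _ _ _ iM (x, g) (x, h)). Qed.

Let phi_src f : gsrc (phi f) = gsrc f. Proof. exact: (morphism_src phiM). Qed.
Let phi_tgt f : gtgt (phi f) = gtgt f. Proof. exact: (morphism_tgt phiM). Qed.

(** Exactness yields a unit at some object; comparing sources shows that the object is [x]. *)
Let phi_i x g : phi (i (x, g)) = gunit Gamma1 x.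
Proof.
have : range i (i (x, g)) by exists (x, g).
rewrite (extension_exact EX) => -[y e]; rewrite e.
by have := congr1 (@gsrc _ _ _) e; rewrite phi_src i_src gsrc_unit /= => ->.
Qed.

Let phi_kernel f x : phi f = gunit Gamma1 x -> exists g, f = i (x, g).
Proof.
move=> fx; have : range i f by rewrite (extension_exact EX); exists x.
move=> [[y g] _ e]; exists g; rewrite -e; congr (i (_, _)).
by rewrite -[y](i_src (y, g)) e -phi_src fx gsrc_unit.
Qed.

Let src_smooth : smooth (@gsrc _ _ Gamma2).
Proof. exact: (gsrc_submersion Gamma2).1.1. Qed.

Let tgt_smooth : smooth (@gtgt _ _ Gamma2).
Proof. exact: (gtgt_submersion Gamma2).1.1. Qed.

Let gcomp_smooth_in (P : manifoldType R) (W : set P) (f g : P -> Gamma2) :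
  open W -> smooth_in W f -> smooth_in W g ->
  (forall x, W x -> gtgt (f x) = gsrc (g x)) ->
  smooth_in W (fun x => gcomp (g x) (f x)).
Proof.
move=> oW fs gs fg.
have gfs := smooth_in_pair oW gs fs.
have fgA x : W x -> [set p : Gamma2 * Gamma2 | gtgt p.2 = gsrc p.1] (g x, f x).
  exact: fg.
exact: (smooth_on_comp oW gfs fgA (@gcomp_smooth _ _ Gamma2)).
Qed.

Let i_smooth_in (P : manifoldType R) (W : set P) (f : P -> M) (g : P -> G) :
  open W -> smooth_in W f -> smooth_in W g -> smooth_in W (fun x => i (f x, g x)).
Proof.
move=> oW fs gs.
apply: (smooth_compr_in (f := fun x => (f x, g x)) oW _ (morphism_smooth1 iM)).
exact: smooth_in_pair.
Qed.

Let fst_smooth : smooth (fst : Gamma2 * G -> Gamma2).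
Proof. exact: smooth_fst. Qed.

Let snd_smooth : smooth (snd : Gamma2 * G -> G). Proof. exact: smooth_snd. Qed.

Let conj_smooth : smooth (fun p : Gamma2 * G => i (gsrc p.1, p.2^-1%g)).
Proof.
apply: i_smooth_in; first exact: openT.
  exact: (smooth_comp fst_smooth src_smooth).
exact: (smooth_comp snd_smooth (@invg_smooth R G)).
Qed.

Let eta_smooth : smooth eta.
Proof.
apply: gcomp_smooth_in; first exact: openT.
- apply: gcomp_smooth_in; [exact: openT|exact: conj_smooth|exact: fst_smooth|].
  by move=> p _; rewrite i_tgt.
- apply: i_smooth_in; [exact: openT| |exact: snd_smooth].
  exact: (smooth_comp fst_smooth tgt_smooth).
by move=> p _; rewrite i_src gtgt_comp // i_tgt.
Qed.

Let act_smooth : smooth act.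
Proof.
apply: gcomp_smooth_in; [exact: openT| |exact: fst_smooth|].
  apply: i_smooth_in; [exact: openT| |exact: snd_smooth].
  exact: (smooth_comp fst_smooth src_smooth).
by move=> p _; rewrite i_tgt.
Qed.

Let eta_src f k : gsrc (eta (f, k)) = gsrc f.
Proof. by rewrite /eta !gsrc_comp ?i_src ?i_tgt // gtgt_comp ?i_tgt. Qed.

Let eta_tgt f k : gtgt (eta (f, k)) = gtgt f.
Proof. by rewrite /eta gtgt_comp ?i_tgt // i_src gtgt_comp ?i_tgt. Qed.

Let act_src f k : gsrc (act (f, k)) = gsrc f.
Proof. by rewrite /act gsrc_comp ?i_src ?i_tgt. Qed.

Let act_tgt f k : gtgt (act (f, k)) = gtgt f.
Proof. by rewrite /act gtgt_comp ?i_tgt. Qed.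

Let iK g h (f : Gamma2) :
  gcomp (i (gtgt f, g)) (gcomp (i (gtgt f, h)) f) =
  gcomp (i (gtgt f, (g * h)%g)) f.
Proof. by rewrite gcompA ?i_src ?i_tgt // i_comp. Qed.

(** The right factor [k^-1] of the conjugation merges with [l]. The cases [l = k2^-1] and
    [l = k2 k1] give the iteration law of [eta] and the functoriality of the action. *)
Let eta_act f k l : act (eta (f, k), l) =
  gcomp (i (gtgt f, k)) (gcomp f (i (gsrc f, (k^-1 * l)%g))).
Proof.
rewrite /act /= eta_src /eta /= -gcompA.
- by rewrite -gcompA ?i_src ?i_tgt ?i_comp // /= i_tgt.
- by rewrite i_tgt gsrc_comp ?i_src ?i_tgt.
- by rewrite i_src gtgt_comp ?i_tgt.
Qed.

Let eta_twisting : twisting_map eta.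
Proof.
split; [exact: eta_smooth|exact: eta_src|exact: eta_tgt| | | |].
- move=> g f k fg; rewrite /eta /= gsrc_comp // gtgt_comp //.
  have e1 : gtgt (gcomp f (i (gsrc f, k^-1%g))) = gtgt f.
    by rewrite gtgt_comp ?i_tgt.
  rewrite -[RHS]gcompA; last 2 first.
  - by rewrite gtgt_comp ?i_tgt ?i_src // gsrc_comp ?i_src ?i_tgt // fg.
  - by rewrite i_src gtgt_comp ?i_tgt.
  congr gcomp; rewrite -[RHS]gcompA; last 2 first.
  - by rewrite gtgt_comp ?i_tgt ?i_src.
  - by rewrite i_tgt.
  rewrite -gcompA ?i_tgt //; congr gcomp.
  (* The factor [k^-1] on the right of [g] meets [k] on the left of [f] at their common object, and
     they cancel. *)
  rewrite -fg -[in RHS]e1 iK e1 mulVg i_unit -{1}e1 gcomp1f //.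
- move=> x k; rewrite /eta /= gsrc_unit gtgt_unit.
  have := gcomp1f (i (x, k^-1%g)); rewrite i_tgt /= => ->.
  by rewrite i_comp mulgV.
- move=> f k2 k1; rewrite {2}/eta /= eta_src eta_tgt.
  have -> : gcomp (eta (f, k1)) (i (gsrc f, k2^-1%g)) =
      act (eta (f, k1), k2^-1%g).
    by rewrite /act /= eta_src.
  rewrite eta_act -invgM.
  have e : gtgt (gcomp f (i (gsrc f, (k2 * k1)^-1%g))) = gtgt f.
    by rewrite gtgt_comp ?i_tgt.
  by rewrite /eta /= -e iK.
- move=> f; rewrite /eta /= invg1 !i_unit gcompf1; exact: gcomp1f.
Qed.

Let act_action : smooth_right_action act.
Proof.
split; first exact: act_smooth.
- by move=> f; rewrite /act /= i_unit gcompf1.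
move=> f g h; rewrite {2}/act /= act_src /act /= -gcompA ?i_src ?i_tgt //.
by rewrite i_comp.
Qed.

Let act_twisted : twisted_action eta act.
Proof.
split; [exact: act_action|exact: act_src|exact: act_tgt| |].
- by move=> x; rewrite (action1 act_action).
move=> g f k2 k1 fg.
have st : gsrc (gcomp g (eta (f, k2))) = gsrc f.
  by rewrite gsrc_comp ?eta_src ?eta_tgt.
rewrite {3}/act /= st -[RHS]gcompA ?i_tgt ?eta_src ?eta_tgt //.
have -> : gcomp (eta (f, k2)) (i (gsrc f, (k2 * k1)%g)) =
    act (eta (f, k2), (k2 * k1)%g).
  by rewrite /act /= eta_src.
(* With [k2^-1 (k2 k1) = k1], both sides become [g], [i k2], [f], [i k1] composed in this order. *)
rewrite eta_act mulKg /act /= -fg -gcompA ?i_src ?i_tgt //.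
by rewrite gtgt_comp ?i_tgt.
Qed.

Let phi_act f g : phi (act (f, g)) = phi f.
Proof.
rewrite /act /= (morphism_comp phiM) ?i_tgt // phi_i -phi_src.
exact: gcompf1.
Qed.

(** The [G] component of the inverse of [i] on its range; outside the range the value 1 is a
    placeholder. *)
Let coord (f : Gamma2) : G := xget 1%g [set g | i (gsrc f, g) = f].

Let coord_i x g : coord (i (x, g)) = g.
Proof.
have := @xgetPex _ 1%g [set h | i (gsrc (i (x, g)), h) = i (x, g)].
rewrite -/(coord (i (x, g))) /= i_src => /(_ (ex_intro _ g erefl)).
by move=> /i_inj [].
Qed.

Let i_coord f : is_gunit (phi f) -> i (gsrc f, coord f) = f.
Proof.
by move=> [x /phi_kernel [g ->]]; rewrite i_src coord_i.
Qed.

Let local_section_trivialization (U : set Gamma1) (s : Gamma1 -> Gamma2) :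
  open U -> smooth_in U s -> (forall y, U y -> phi (s y) = y) ->
  local_trivialization phi act U
    (fun f => (phi f, coord (gcomp (ginv (s (phi f))) f)))
    (fun q => gcomp (s q.1) (i (gsrc (s q.1), q.2))).
Proof.
move=> oU ss phis.
have sphi : smooth phi := morphism_smooth1 phiM.
have oV : open (phi @^-1` U) := preimage_smooth_open sphi oU.
have oUT : open (U `*` [set: G]) by apply: open_setX => //; exact: openT.
have src_s y : U y -> gsrc (s y) = gsrc y by move=> /phis {2}<-; rewrite phi_src.
have tgt_s y : U y -> gtgt (s y) = gtgt y by move=> /phis {2}<-; rewrite phi_tgt.
pose h f := gcomp (ginv (s (phi f))) f.
have fs f : U (phi f) -> gtgt f = gsrc (ginv (s (phi f))).
  by move=> Uf; rewrite gsrc_inv tgt_s // phi_tgt.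
have h_src f : U (phi f) -> gsrc (h f) = gsrc f.
  by move=> Uf; rewrite /h gsrc_comp //; exact: fs.
have h_unit f : U (phi f) -> is_gunit (phi (h f)).
  move=> Uf; exists (gsrc (s (phi f))).
  rewrite /h (morphism_comp phiM); last exact: fs.
  (* Writing [phi f] as [phi (s (phi f))] turns the composite into the image of [s^-1 o s], a
     unit. *)
  rewrite -{2}(phis _ Uf) -(morphism_comp phiM) ?gsrc_inv // gcompVg.
  by rewrite (morphism_unit phiM).
have h_smooth : smooth_in (phi @^-1` U) h.
  apply: gcomp_smooth_in => //; first exact: smooth_smooth_in (@smooth_id R _).
  apply: (smooth_compr_in oV _ (ginv_smooth Gamma2)).
  by apply: (smooth_in_comp oV oU _ _ ss) => //; exact: smooth_smooth_in.
split.
- apply: smooth_in_pair => //; first exact: smooth_smooth_in.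
  apply: (smooth_compr_in (f := fun f => (gsrc f, coord (h f))) oV _
    (@smooth_snd R M G)).
  (* The pair (source, coordinate) is the lift of the smooth map [h] through the embedding [i]. *)
  apply: (embedding_lift_smooth (extension_embedding EX) oV h_smooth) => f Uf.
  by rewrite -[in LHS]h_src // i_coord //; exact: h_unit.
- have s1 : smooth_in (U `*` [set: G]) (s \o fst).
    apply: (smooth_in_comp oUT oU _ _ ss) => [q []//|].
    exact: smooth_smooth_in (@smooth_fst R _ _).
  apply: gcomp_smooth_in; [exact: oUT| |exact: s1|by move=> q _; rewrite i_tgt].
  apply: i_smooth_in; [exact: oUT| |].
    exact: (smooth_compr_in oUT s1 src_smooth).
  exact: smooth_smooth_in (@smooth_snd R _ _).
- move=> f Uf; split => //=.
  rewrite src_s // phi_src -(h_src f Uf) i_coord; last exact: h_unit.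
  by rewrite gcompKV // tgt_s // phi_tgt.
- move=> [y g] /= Uy.
  have e : phi (gcomp (s y) (i (gsrc (s y), g))) = y.
    by rewrite -[RHS](phis _ Uy) -(phi_act (s y) g).
  by rewrite e; split => //; rewrite gcompVK ?i_tgt // coord_i.
move=> f g Uf /=; rewrite phi_act; congr (_, _).
(* Equivariance: acting by [g] multiplies [h f = i (coord (h f))] on the right by [i g]. *)
have hE := i_coord (h_unit f Uf); rewrite h_src // in hE.
rewrite /act /= gcompA ?i_tgt //; last exact: fs.
by rewrite -/(h f) -[in LHS]hE i_comp coord_i.
Qed.

Lemma extension_twisted_bundle :
  twisted_principal_bundle (idfun : M -> M) phi eta act.
Proof.
split; [exact: phiM|exact: eta_twisting|exact: act_twisted| |].
  by split; [exact: smooth_id|exists idfun; split => //; exact: smooth_id].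
split; [exact: morphism_smooth1 phiM|exact: act_action|exact: phi_act|].
move=> b; have [sub surj] := extension_submersion EX; have [p pb] := surj b.
have [U [s [oU Ub ss _ phis]]] := submersion_has_section p sub.
exists U; do 2 eexists; split; first exact: oU.
  by rewrite -pb.
exact: local_section_trivialization oU ss phis.
Qed.

End extension_to_bundle.
Unset Implicit Arguments.

Theorem proposition3p10 (R : realType) (G : lieGroupType R) :
  (forall (X0 : manifoldType R) (E X : lieGroupoid X0) (pi1 : E -> X)
      (eta act : E * G -> E),
    twisted_principal_bundle idfun pi1 eta act ->
    @lie_groupoid_extension R X0 G E X
      (fun p => act (gunit E p.1, p.2)) pi1)
  /\
  (forall (M : manifoldType R) (Gamma2 Gamma1 : lieGroupoid M)
      (i : group_bundle M G -> Gamma2) (phi : Gamma2 -> Gamma1),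
    lie_groupoid_extension i phi ->
    twisted_principal_bundle (idfun : M -> M) phi
      (fun p => gcomp (i (gtgt p.1, p.2))
                      (gcomp p.1 (i (gsrc p.1, p.2^-1%g))))
      (fun p => gcomp p.1 (i (gsrc p.1, p.2)))).
Proof.
split=> [X0 E X pi1 eta act|M Gamma2 Gamma1 i phi].
  exact: twisted_bundle_extension.
exact: extension_twisted_bundle.
Qed.
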